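(* Let $k$ be a field and let $E_1,\dots,E_n$ and $F_1,\dots,F_m$ be finite quivers ($n,m\ge 1$). Assume that $n\ne m$ and that each of the $E_i$ and each of the $F_j$ has at least one non-trivial closed path. Then the $k$-algebras $L(E_1)\otimes\cdots\otimes L(E_n)$ and $L(F_1)\otimes\cdots\otimes L(F_m)$ are not Morita equivalent.
   Context: All algebras and tensor products are over the field $k$. Morita equivalence of unital $k$-algebras $R,S$ is understood over $k$, i.e. implemented by an $R\otimes S^{op}$-module $P$ and an $S\otimes R^{op}$-module $Q$. A finite quiver $E=(E_0,E_1,r,s)$ has finite sets $E_0$ of vertices and $E_1$ of arrows, and range and source maps $r,s:E_1\to E_0$. A sink is a vertex that is not the source of any arrow; $\mathrm{Sink}(E)$ is the set of sinks. Paths $\alpha_1\cdots\alpha_l$ satisfy $r(\alpha_i)=s(\alpha_{i+1})$; a non-trivial closed path is a path of length $\ge1$ whose source and range coincide. Leavitt path algebra: let $\hat E$ be the quiver obtained from $E$ by adding, for each $\alpha\in E_1$, an arrow $\alpha^*$ in the opposite direction ($s(\alpha^* )=r(\alpha)$, $r(\alpha^* )=s(\alpha)$). $L(E)$ is the $k$-algebra with generators $p_i$ ($i\in E_0$) and $\alpha\in\hat E_1$, and relations: $p_ip_j=\delta_{i,j}p_i$ ($i,j\in E_0$); $p_{s(\alpha)}\alpha=\alpha=\alpha p_{r(\alpha)}$ ($\alpha\in\hat E_1$); $\alpha^*\beta=\delta_{\alpha,\beta}p_{r(\alpha)}$ ($\alpha,\beta\in E_1$); $p_i=\sum_{\alpha\in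 E_1,\,s(\alpha)=i}\alpha\alpha^*$ ($i\in E_0\setminus\mathrm{Sink}(E)$). It is unital with unit $\sum_{i\in E_0}p_i$. *)

(* Defs.v *)
From HB Require Import structures.
From mathcomp Require Import all_boot all_algebra.
From mathcomp Require Import boolp.

Set Implicit Arguments.
Unset Strict Implicit.
Unset Printing Implicit Defensive.

Import GRing.Theory.
Local Open Scope ring_scope.
Local Open Scope quotient_scope.

(* MathComp's [algType k] excludes the zero ring, while the Leavitt path       *)
(* algebra of the empty quiver is zero.  A unital k-algebra is therefore a     *)
(* possibly trivial ring with a ring morphism from k to its centre.            *)
HB.mixin Record PzRing_isKAlgebra (k : fieldType) A of GRing.PzRing A := {
  scal : k -> A;
  scal1 : scal 1 = 1;
  scalD : forall c d, scal (c + d) = scal c + scal d;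
  scalM : forall c d, scal (c * d) = scal c * scal d;
  scalC : forall c a, scal c * a = a * scal c }.

#[short(type="kalgType")]
HB.structure Definition KAlgebra (k : fieldType) :=
  {A of GRing.PzRing A & PzRing_isKAlgebra k A}.

HB.instance Definition _ (k : fieldType) :=
  PzRing_isKAlgebra.Build k k^o (erefl 1) (fun _ _ => erefl)
    (fun _ _ => erefl) (fun c a => mulrC c a).

Section OppositeAlgebra.
Variables (k : fieldType) (A : kalgType k).

Fact opp_scalM (c d : k) : (scal (c * d) : A^c) = (scal c : A^c) * (scal d : A^c).
Proof. by rewrite mulrC scalM. Qed.

Fact opp_scalC (c : k) (a : A^c) : (scal c : A^c) * a = a * (scal c : A^c).
Proof. exact/esym/(@scalC k A). Qed.

HB.instance Definition _ :=
  PzRing_isKAlgebra.Build k A^c (@scal1 k A) (@scalD k A) opp_scalM opp_scalC.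

End OppositeAlgebra.

(* Balanced tensor product of an abelian group P with a right action of S and  *)
(* an abelian group Q with a left action of S: the abelian group generated by  *)
(* the symbols [BtPure p q], subject to biadditivity and ps (x) q = p (x) sq.  *)
Section BalancedTensor.
Variables (S : Type) (P Q : zmodType) (ract : P -> S -> P) (lact : S -> Q -> Q).

Inductive bt_term : Type :=
| BtZero
| BtOpp (t : bt_term)
| BtAdd (t u : bt_term)
| BtPure (p : P) (q : Q).

Inductive bt_rel : bt_term -> bt_term -> Prop :=
| bt_refl t : bt_rel t t
| bt_sym t u : bt_rel t u -> bt_rel u t
| bt_trans t u v : bt_rel t u -> bt_rel u v -> bt_rel t v
| bt_opp t t' : bt_rel t t' -> bt_rel (BtOpp t) (BtOpp t')
| bt_add t t' u u' :
    bt_rel t t' -> bt_rel u u' -> bt_rel (BtAdd t u) (BtAdd t' u')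
| bt_addA t u v : bt_rel (BtAdd t (BtAdd u v)) (BtAdd (BtAdd t u) v)
| bt_addC t u : bt_rel (BtAdd t u) (BtAdd u t)
| bt_add0 t : bt_rel (BtAdd BtZero t) t
| bt_addN t : bt_rel (BtAdd (BtOpp t) t) BtZero
| bt_pureDl p p' q :
    bt_rel (BtPure (p + p') q) (BtAdd (BtPure p q) (BtPure p' q))
| bt_pureDr p q q' :
    bt_rel (BtPure p (q + q')) (BtAdd (BtPure p q) (BtPure p q'))
| bt_bal p s q : bt_rel (BtPure (ract p s) q) (BtPure p (lact s q)).

HB.instance Definition _ := gen_eqMixin bt_term.
HB.instance Definition _ := gen_choiceMixin bt_term.

Definition bt_relb : rel bt_term := fun t u => `[< bt_rel t u >].

Fact bt_relb_refl : reflexive bt_relb.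
Proof. by move=> t; apply/asboolP; apply: bt_refl. Qed.

Fact bt_relb_sym : symmetric bt_relb.
Proof. by move=> t u; apply/asboolP/asboolP; apply: bt_sym. Qed.

Fact bt_relb_trans : transitive bt_relb.
Proof.
by move=> u t v /asboolP tu /asboolP uv; apply/asboolP; apply: bt_trans uv.
Qed.

Definition bt_equiv := EquivRel bt_relb bt_relb_refl bt_relb_sym bt_relb_trans.

Definition btensor : Type := {eq_quot bt_equiv}.
HB.instance Definition _ := Choice.on btensor.
HB.instance Definition _ := Quotient.on btensor.

Lemma btensorP t u : \pi_btensor t = \pi_btensor u <-> bt_rel t u.
Proof.
split=> [/eqquotP|tu]; first by move/asboolP.
by apply/eqquotP; apply/asboolP.
Qed.

Definition bt_pure (p : P) (q : Q) : btensor := \pi_btensor (BtPure p q).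
Definition bt_zero : btensor := \pi_btensor BtZero.
Definition bt_oppq (x : btensor) : btensor := \pi_btensor (BtOpp (repr x)).
Definition bt_addq (x y : btensor) : btensor := \pi_btensor (BtAdd (repr x) (repr y)).

Fact repr_bt t : bt_rel (repr (\pi_btensor t)) t.
Proof. by apply/btensorP; rewrite reprK. Qed.

Fact bt_addqE t u : bt_addq (\pi_btensor t) (\pi_btensor u) = \pi_btensor (BtAdd t u).
Proof. by apply/btensorP/bt_add; apply: repr_bt. Qed.

Fact bt_oppqE t : bt_oppq (\pi_btensor t) = \pi_btensor (BtOpp t).
Proof. by apply/btensorP/bt_opp; apply: repr_bt. Qed.

Fact bt_addqA : associative bt_addq.
Proof.
elim/quotW=> t; elim/quotW=> u; elim/quotW=> v; rewrite (bt_addqE u v) (bt_addqE t u) !bt_addqE.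
exact/btensorP/bt_addA.
Qed.

Fact bt_addqC : commutative bt_addq.
Proof.
by elim/quotW=> t; elim/quotW=> u; rewrite (bt_addqE t) (bt_addqE u); apply/btensorP/bt_addC.
Qed.

Fact bt_add0q : left_id bt_zero bt_addq.
Proof. by elim/quotW=> t; rewrite bt_addqE; apply/btensorP/bt_add0. Qed.

Fact bt_addNq : left_inverse bt_zero bt_oppq bt_addq.
Proof.
by elim/quotW=> t; rewrite bt_oppqE bt_addqE; apply/btensorP/bt_addN.
Qed.

HB.instance Definition _ :=
  GRing.isZmodule.Build btensor bt_addqA bt_addqC bt_add0q bt_addNq.

Lemma bt_pureDlE p p' q : bt_pure (p + p') q = bt_pure p q + bt_pure p' q.
Proof. by rewrite [RHS]bt_addqE; apply/btensorP/bt_pureDl. Qed.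

Lemma bt_pureDrE p q q' : bt_pure p (q + q') = bt_pure p q + bt_pure p q'.
Proof. by rewrite [RHS]bt_addqE; apply/btensorP/bt_pureDr. Qed.

Lemma bt_balE p s q : bt_pure (ract p s) q = bt_pure p (lact s q).
Proof. exact/btensorP/bt_bal. Qed.

Lemma bt_pure0l q : bt_pure 0 q = 0.
Proof. by apply: (addrI (bt_pure 0 q)); rewrite -bt_pureDlE !addr0. Qed.

Lemma bt_pureNl p q : bt_pure (- p) q = - bt_pure p q.
Proof.
by apply: (addrI (bt_pure p q)); rewrite -bt_pureDlE !subrr bt_pure0l.
Qed.

Lemma btensor_ind (K : btensor -> Prop) :
  (forall p q, K (bt_pure p q)) -> (forall x y, K x -> K y -> K (x + y)) ->
  forall x, K x.
Proof.
move=> Kp KD; elim/quotW=> t.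
suff: K (\pi_btensor t) /\ K (- \pi_btensor t) by case.
elim: t => [|t [Kt KNt]|t [Kt KNt] u [Ku KNu]|p q].
- have -> : \pi_btensor BtZero = 0 :> btensor by [].
  by rewrite oppr0 -(bt_pure0l 0).
- have -> : \pi_btensor (BtOpp t) = - (\pi_btensor t) :> btensor by rewrite [RHS]bt_oppqE.
  by rewrite opprK.
- have -> : \pi_btensor (BtAdd t u) = \pi_btensor t + \pi_btensor u :> btensor
    by rewrite [RHS]bt_addqE.
  by rewrite opprD; split; apply: KD.
- by split; [apply: Kp | rewrite -[X in - X]/(bt_pure p q) -bt_pureNl].
Qed.

Section Lift.
Variables (G : zmodType) (f : P -> Q -> G).

Fixpoint bt_eval (t : bt_term) : G :=
  match t with
  | BtZero => 0
  | BtOpp t => - bt_eval t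
  | BtAdd t u => bt_eval t + bt_eval u
  | BtPure p q => f p q
  end.

(* The additive map p (x) q |-> f p q; meaningful for biadditive balanced f.   *)
Definition bt_lift (x : btensor) : G := bt_eval (repr x).

Hypothesis fDl : forall p p' q, f (p + p') q = f p q + f p' q.
Hypothesis fDr : forall p q q', f p (q + q') = f p q + f p q'.
Hypothesis fbal : forall p s q, f (ract p s) q = f p (lact s q).

Lemma bt_evalP t u : bt_rel t u -> bt_eval t = bt_eval u.
Proof.
elim=> //=; do ?by move=> *; rewrite ?(addrA, add0r, addNr) //; congruence.
by move=> *; rewrite addrC.
Qed.

Lemma bt_lift_pi t : bt_lift (\pi_btensor t) = bt_eval t.
Proof. exact/bt_evalP/repr_bt. Qed.

Lemma bt_liftE p q : bt_lift (bt_pure p q) = f p q.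
Proof. exact: bt_lift_pi. Qed.

Lemma bt_liftD x y : bt_lift (x + y) = bt_lift x + bt_lift y.
Proof.
by elim/quotW: x => t; elim/quotW: y => u; rewrite [_ + _]bt_addqE !bt_lift_pi.
Qed.

End Lift.

End BalancedTensor.

Arguments bt_pure {S P Q ract lact} p q.
Arguments bt_lift {S P Q ract lact G} f x.
Arguments btensor_ind {S P Q ract lact} K _ _ x.

Section AlgebraTensor.
Variables (k : fieldType) (A B : kalgType k).

Definition tensor : Type :=
  btensor (fun (a : A) (c : k) => a * scal c) (fun (c : k) (b : B) => scal c * b).
HB.instance Definition _ := GRing.Zmodule.on tensor.

Definition pure (a : A) (b : B) : tensor := bt_pure a b.

Definition tensor_mul (x y : tensor) : tensor :=
  bt_lift (fun a b => bt_lift (fun a' b' => pure (a * a') (b * b')) y) x.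

Lemma pureDl a a' b : pure (a + a') b = pure a b + pure a' b.
Proof. exact: bt_pureDlE. Qed.

Lemma pureDr a b b' : pure a (b + b') = pure a b + pure a b'.
Proof. exact: bt_pureDrE. Qed.

Lemma pure_bal a c b : pure (a * scal c) b = pure a (scal c * b).
Proof. exact: bt_balE. Qed.

Lemma tensor_ind (K : tensor -> Prop) :
  (forall a b, K (pure a b)) -> (forall x y, K x -> K y -> K (x + y)) ->
  forall x, K x.
Proof. exact: btensor_ind. Qed.

Let inner (a : A) (b : B) : tensor -> tensor :=
  bt_lift (fun a' b' => pure (a * a') (b * b')).

Let innerE a b a' b' : inner a b (pure a' b') = pure (a * a') (b * b').
Proof.
apply: bt_liftE => [p p' q|p q q'|p c q].
- by rewrite mulrDr pureDl.
- by rewrite mulrDr pureDr.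
- by rewrite mulrA pure_bal !mulrA scalC.
Qed.

Let innerD a b x y : inner a b (x + y) = inner a b x + inner a b y.
Proof.
apply: bt_liftD => [p p' q|p q q'|p c q].
- by rewrite mulrDr pureDl.
- by rewrite mulrDr pureDr.
- by rewrite mulrA pure_bal !mulrA scalC.
Qed.

Let innerDl a a' b x : inner (a + a') b x = inner a b x + inner a' b x.
Proof.
elim/tensor_ind: x => [p q|x y IHx IHy]; first by rewrite !innerE mulrDl pureDl.
by rewrite !innerD IHx IHy addrACA.
Qed.

Let innerDr a b b' x : inner a (b + b') x = inner a b x + inner a b' x.
Proof.
elim/tensor_ind: x => [p q|x y IHx IHy]; first by rewrite !innerE mulrDl pureDr.
by rewrite !innerD IHx IHy addrACA.
Qed.

Let inner_bal a c b x : inner (a * scal c) b x = inner a (scal c * b) x.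
Proof.
elim/tensor_ind: x => [p q|x y IHx IHy]; last by rewrite !innerD IHx IHy.
by rewrite !innerE -mulrA scalC mulrA pure_bal mulrA.
Qed.

Lemma tensor_mulE a b a' b' :
  tensor_mul (pure a b) (pure a' b') = pure (a * a') (b * b').
Proof.
rewrite -innerE; apply: (@bt_liftE _ _ _ _ _ _ (fun a b => inner a b _)) => *.
- exact: innerDl.
- exact: innerDr.
- exact: inner_bal.
Qed.

Fact tensor_mulDl : left_distributive tensor_mul +%R.
Proof.
move=> x y z; apply: (@bt_liftD _ _ _ _ _ _ (fun a b => inner a b _)) => *.
- exact: innerDl.
- exact: innerDr.
- exact: inner_bal.
Qed.

Let tensor_mul_pure a b x : tensor_mul (pure a b) x = inner a b x.
Proof.
apply: (@bt_liftE _ _ _ _ _ _ (fun a b => inner a b _)) => *.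
- exact: innerDl.
- exact: innerDr.
- exact: inner_bal.
Qed.

Fact tensor_mulDr : right_distributive tensor_mul +%R.
Proof.
move=> x y z; elim/tensor_ind: x => [a b|x x' IHx IHx'].
  by rewrite !tensor_mul_pure innerD.
by rewrite !tensor_mulDl IHx IHx' addrACA.
Qed.

Fact tensor_mulA : associative tensor_mul.
Proof.
move=> x y z; elim/tensor_ind: x => [a b|x x' IHx IHx']; last first.
  by rewrite !tensor_mulDl IHx IHx'.
elim/tensor_ind: y => [a' b'|y y' IHy IHy']; last first.
  by rewrite !(tensor_mulDl, tensor_mulDr) IHy IHy'.
elim/tensor_ind: z => [a'' b''|z z' IHz IHz']; last first.
  by rewrite !tensor_mulDr IHz IHz'.
by rewrite !tensor_mulE !mulrA.
Qed.

Fact tensor_mul1 : left_id (pure 1 1) tensor_mul.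
Proof.
move=> x; elim/tensor_ind: x => [a b|x y IHx IHy]; first by rewrite tensor_mulE !mul1r.
by rewrite tensor_mulDr IHx IHy.
Qed.

Fact tensor_mulr1 : right_id (pure 1 1) tensor_mul.
Proof.
move=> x; elim/tensor_ind: x => [a b|x y IHx IHy]; first by rewrite tensor_mulE !mulr1.
by rewrite tensor_mulDl IHx IHy.
Qed.

HB.instance Definition _ :=
  GRing.Zmodule_isPzRing.Build tensor tensor_mulA tensor_mul1 tensor_mulr1
    tensor_mulDl tensor_mulDr.

Lemma pureM a b a' b' : pure a b * pure a' b' = pure (a * a') (b * b').
Proof. exact: tensor_mulE. Qed.

Definition tensor_scal (c : k) : tensor := pure (scal c) 1.

Fact tensor_scal1 : tensor_scal 1 = 1.
Proof. by rewrite /tensor_scal scal1. Qed.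

Fact tensor_scalD c d : tensor_scal (c + d) = tensor_scal c + tensor_scal d.
Proof. by rewrite /tensor_scal scalD pureDl. Qed.

Fact tensor_scalM c d : tensor_scal (c * d) = tensor_scal c * tensor_scal d.
Proof. by rewrite pureM mulr1 -scalM. Qed.

Fact tensor_scalC c x : tensor_scal c * x = x * tensor_scal c.
Proof.
elim/tensor_ind: x => [a b|x y IHx IHy]; last by rewrite mulrDl mulrDr IHx IHy.
by rewrite !pureM mul1r mulr1 scalC.
Qed.

HB.instance Definition _ :=
  PzRing_isKAlgebra.Build k tensor tensor_scal1 tensor_scalD tensor_scalM
    tensor_scalC.

End AlgebraTensor.

Arguments pure {k A B} a b.
Arguments tensor_ind {k A B} K _ _ x.

(* [:: A_1; ...; A_n] |-> A_1 (x) (A_2 (x) ...), with value k when n = 0.      *)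
Fixpoint tensor_seq (k : fieldType) (As : seq (kalgType k)) : kalgType k :=
  match As with
  | [::] => k^o
  | [:: A] => A
  | A :: As' => tensor A (tensor_seq As')
  end.

Definition bigtensor (k : fieldType) (n : nat) (A : 'I_n -> kalgType k) :
  kalgType k := tensor_seq [seq A i | i <- enum 'I_n].

(* An (R, S)-bimodule over k is a module over R (x) S^c, with S^c the opposite *)
(* algebra of S.                                                               *)
Section BimoduleActions.
Variables (k : fieldType) (R S : kalgType k) (P : lmodType (tensor R S^c)).

Definition lmul (r : R) (p : P) : P := pure r (1 : S^c) *: p.
Definition rmul (p : P) (s : S) : P := pure 1 (s : S^c) *: p.

Lemma lmulDl r r' p : lmul (r + r') p = lmul r p + lmul r' p.
Proof. by rewrite /lmul pureDl scalerDl. Qed.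

Lemma lmulDr r p p' : lmul r (p + p') = lmul r p + lmul r p'.
Proof. exact: scalerDr. Qed.

Lemma rmulDl p p' s : rmul (p + p') s = rmul p s + rmul p' s.
Proof. exact: scalerDr. Qed.

Lemma rmulDr p s s' : rmul p (s + s') = rmul p s + rmul p s'.
Proof.
by rewrite /rmul -scalerDl; congr (_ *: _); apply: (@pureDr _ R S^c).
Qed.

Lemma lmulA r r' p : lmul r (lmul r' p) = lmul (r * r') p.
Proof. by rewrite /lmul scalerA pureM mulr1. Qed.

Lemma rmulA p s s' : rmul (rmul p s) s' = rmul p (s * s').
Proof. by rewrite /rmul scalerA pureM mulr1. Qed.

Lemma lrmulC r p s : lmul r (rmul p s) = rmul (lmul r p) s.
Proof. by rewrite /lmul /rmul !scalerA !pureM !(mulr1, mul1r). Qed.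

Lemma lmul1 p : lmul 1 p = p. Proof. exact: scale1r. Qed.

Lemma rmul1 p : rmul p 1 = p. Proof. exact: scale1r. Qed.

Lemma lrmul_scal (c : k) p : lmul (scal c) p = rmul p (scal c).
Proof.
rewrite /lmul /rmul -[scal c in LHS]mul1r pure_bal.
by congr (pure _ _ *: _); rewrite mulr1.
Qed.

End BimoduleActions.

Section BimoduleTensor.
Variables (k : fieldType) (R S T : kalgType k).
Variables (P : lmodType (tensor R S^c)) (Q : lmodType (tensor S T^c)).

(* P (x)_S Q, with (r (x) t) (p (x) q) = rp (x) qt.                            *)
Definition bimod_tensor : Type := btensor (@rmul k R S P) (@lmul k S T Q).
HB.instance Definition _ := GRing.Zmodule.on bimod_tensor.

Definition bpure (p : P) (q : Q) : bimod_tensor := bt_pure p q.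

Definition bimod_tensor_scale (x : tensor R T^c) (y : bimod_tensor) :
    bimod_tensor :=
  bt_lift (fun (r : R) (t : T^c) =>
             bt_lift (fun p q => bpure (lmul r p) (rmul q (t : T))) y) x.

Lemma bpureDl p p' q : bpure (p + p') q = bpure p q + bpure p' q.
Proof. exact: bt_pureDlE. Qed.

Lemma bpureDr p q q' : bpure p (q + q') = bpure p q + bpure p q'.
Proof. exact: bt_pureDrE. Qed.

Lemma bpure_bal p s q : bpure (rmul p s) q = bpure p (lmul s q).
Proof. exact: bt_balE. Qed.

Lemma bimod_tensor_ind (K : bimod_tensor -> Prop) :
  (forall p q, K (bpure p q)) -> (forall x y, K x -> K y -> K (x + y)) ->
  forall x, K x.
Proof. exact: btensor_ind. Qed.

Let inner (r : R) (t : T^c) : bimod_tensor -> bimod_tensor :=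
  bt_lift (fun p q => bpure (lmul r p) (rmul q (t : T))).

Let innerE r t p q : inner r t (bpure p q) = bpure (lmul r p) (rmul q (t : T)).
Proof.
apply: bt_liftE => [p1 p2 q1|p1 q1 q2|p1 s q1].
- by rewrite lmulDr bpureDl.
- by rewrite rmulDl bpureDr.
- by rewrite lrmulC bpure_bal lrmulC.
Qed.

Let innerD r t x y : inner r t (x + y) = inner r t x + inner r t y.
Proof.
apply: bt_liftD => [p1 p2 q1|p1 q1 q2|p1 s q1].
- by rewrite lmulDr bpureDl.
- by rewrite rmulDl bpureDr.
- by rewrite lrmulC bpure_bal lrmulC.
Qed.

Let innerDl r r' t y : inner (r + r') t y = inner r t y + inner r' t y.
Proof.
elim/bimod_tensor_ind: y => [p q|x y IHx IHy].
  by rewrite !innerE lmulDl bpureDl.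
by rewrite !innerD IHx IHy addrACA.
Qed.

Let innerDr r t t' y : inner r (t + t') y = inner r t y + inner r t' y.
Proof.
elim/bimod_tensor_ind: y => [p q|x y IHx IHy].
  by rewrite !innerE (rmulDr q (t : T) t') bpureDr.
by rewrite !innerD IHx IHy addrACA.
Qed.

Let inner_bal r (c : k) t y : inner (r * scal c) t y = inner r (scal c * t) y.
Proof.
elim/bimod_tensor_ind: y => [p q|x y IHx IHy]; last by rewrite !innerD IHx IHy.
rewrite !innerE -lmulA lrmul_scal lrmulC bpure_bal lrmul_scal rmulA.
by congr (bpure _ (rmul _ _)); apply: scalC.
Qed.

Let scale_pure r t y : bimod_tensor_scale (pure r t) y = inner r t y.
Proof.
apply: (@bt_liftE _ _ _ _ _ _ (fun a b => inner a b _)) => *.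
- exact: innerDl.
- exact: innerDr.
- exact: inner_bal.
Qed.

Let scaleDl x x' y :
  bimod_tensor_scale (x + x') y = bimod_tensor_scale x y + bimod_tensor_scale x' y.
Proof.
apply: (@bt_liftD _ _ _ _ _ _ (fun a b => inner a b _)) => *.
- exact: innerDl.
- exact: innerDr.
- exact: inner_bal.
Qed.

Let scaleDr : right_distributive bimod_tensor_scale +%R.
Proof.
move=> x y y'; elim/(@tensor_ind k R T^c): x => [r t|x x' IHx IHx'].
  by rewrite !scale_pure innerD.
by rewrite !scaleDl IHx IHx' addrACA.
Qed.

Let scaleA x x' y :
  bimod_tensor_scale x (bimod_tensor_scale x' y) = bimod_tensor_scale (x * x') y.
Proof.
elim/(@tensor_ind k R T^c): x => [r t|x z IHx IHz]; last by rewrite mulrDl !scaleDl IHx IHz.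
elim/(@tensor_ind k R T^c): x' => [r' t'|x z IHx IHz].
  rewrite pureM !scale_pure; elim/bimod_tensor_ind: y => [p q|y z IHy IHz].
    by rewrite !innerE lmulA rmulA.
  by rewrite !innerD IHy IHz.
by rewrite mulrDr !scaleDl scaleDr IHx IHz.
Qed.

Let scale1 : left_id 1 bimod_tensor_scale.
Proof.
move=> y; rewrite [LHS]scale_pure.
elim/bimod_tensor_ind: y => [p q|x y IHx IHy]; last by rewrite innerD IHx IHy.
by rewrite innerE lmul1 rmul1.
Qed.

HB.instance Definition _ :=
  GRing.Zmodule_isLmodule.Build (tensor R T^c) bimod_tensor scaleA scale1 scaleDr
    (fun y x x' => scaleDl x x' y).

Lemma bimod_tensor_scaleE (r : R) (t : T) p q :
  pure r (t : T^c) *: bpure p q = bpure (lmul r p) (rmul q (t : T)).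
Proof. by rewrite [LHS]scale_pure innerE. Qed.

End BimoduleTensor.

Section RegularBimodule.
Variables (k : fieldType) (R : kalgType k).

(* R as a module over R (x) R^c: (r (x) s) a = r a s.                          *)
Definition regbimod : Type := R.
HB.instance Definition _ := GRing.Zmodule.on regbimod.

Definition regbimod_scale (x : tensor R R^c) (a : regbimod) : regbimod :=
  bt_lift (fun (r : R) (s : R^c) => r * (a : R) * (s : R)) x.

Let scale_pure (r : R) (s : R^c) (a : R) :
  regbimod_scale (pure r s) a = r * a * (s : R).
Proof.
apply: (bt_liftE (f := fun (r : R) (s : R^c) => r * (a : R) * (s : R)))
  => [r1 r2 s1|r1 s1 s2|r1 c s1].
- by rewrite !mulrDl.
- exact: mulrDr.
- rewrite -(mulrA r1) scalC mulrA -mulrA; congr (_ * _); exact: scalC.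
Qed.

Let scaleDl x y a :
  regbimod_scale (x + y) a = regbimod_scale x a + regbimod_scale y a.
Proof.
apply: (bt_liftD (f := fun (r : R) (s : R^c) => r * (a : R) * (s : R)))
  => [r1 r2 s1|r1 s1 s2|r1 c s1].
- by rewrite !mulrDl.
- exact: mulrDr.
- rewrite -(mulrA r1) scalC mulrA -mulrA; congr (_ * _); exact: scalC.
Qed.

Let scaleDr : right_distributive regbimod_scale +%R.
Proof.
move=> x a b; elim/(@tensor_ind k R R^c): x => [r s|x y IHx IHy].
  by rewrite !scale_pure mulrDr mulrDl.
by rewrite !scaleDl IHx IHy addrACA.
Qed.

Let scaleA x y a :
  regbimod_scale x (regbimod_scale y a) = regbimod_scale (x * y) a.
Proof.
elim/(@tensor_ind k R R^c): x => [r s|x z IHx IHz]; last by rewrite mulrDl !scaleDl IHx IHz.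
elim/(@tensor_ind k R R^c): y => [r' s'|x z IHx IHz].
  by rewrite pureM !scale_pure !mulrA.
by rewrite mulrDr !scaleDl scaleDr IHx IHz.
Qed.

Let scale1 : left_id 1 regbimod_scale.
Proof. by move=> a; rewrite [LHS]scale_pure mul1r mulr1. Qed.

HB.instance Definition _ :=
  GRing.Zmodule_isLmodule.Build (tensor R R^c) regbimod scaleA scale1 scaleDr
    (fun a x y => scaleDl x y a).

Lemma regbimod_scaleE (r s : R) (a : regbimod) :
  pure r (s : R^c) *: a = (r * (a : R) * s : R).
Proof. exact: scale_pure. Qed.

End RegularBimodule.

Definition lmod_iso (A : pzRingType) (M N : lmodType A) : Prop :=
  exists f : {linear M -> N}, bijective f.

Definition morita_equivalent (k : fieldType) (R S : kalgType k) : Prop :=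
  exists (P : lmodType (tensor R S^c)) (Q : lmodType (tensor S R^c)),
    lmod_iso (bimod_tensor P Q) (regbimod R) /\
    lmod_iso (bimod_tensor Q P) (regbimod S).

Record quiver := Quiver {
  vertex : finType;
  arrow : finType;
  rng : arrow -> vertex;
  src : arrow -> vertex }.

Definition sink (E : quiver) (i : vertex E) : bool :=
  [forall a : arrow E, src a != i].

(* a :: p ranges over the non-empty sequences of arrows.                       *)
Definition has_nontrivial_closed_path (E : quiver) : Prop :=
  exists (a : arrow E) (p : seq (arrow E)),
    path (fun b c : arrow E => rng b == src c) a p /\ src a = rng (last a p).

(* [inl a] is the arrow a of E and [inr a] is the added arrow a^*.             *)
Definition double_quiver (E : quiver) : quiver :=
  @Quiver (vertex E) (arrow E + arrow E)%type
    (fun a => match a with inl a => rng a | inr a => src a end)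
    (fun a => match a with inl a => src a | inr a => rng a end).

Section Leavitt.
Variables (k : fieldType) (E : quiver).

(* Terms and relations of the presentation of L(E) as a k-algebra that is not  *)
(* assumed to be unital: the unit sum_i p_i is obtained below.                 *)
Inductive lpa_term : Type :=
| LVertex (i : vertex E)
| LArrow (a : arrow (double_quiver E))
| LZero
| LOpp (t : lpa_term)
| LAdd (t u : lpa_term)
| LScale (c : k) (t : lpa_term)
| LMul (t u : lpa_term).

Inductive lpa_rel : lpa_term -> lpa_term -> Prop :=
| lpa_refl t : lpa_rel t t
| lpa_sym t u : lpa_rel t u -> lpa_rel u t
| lpa_trans t u v : lpa_rel t u -> lpa_rel u v -> lpa_rel t v
| lpa_opp t t' : lpa_rel t t' -> lpa_rel (LOpp t) (LOpp t')
| lpa_add t t' u u' :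
    lpa_rel t t' -> lpa_rel u u' -> lpa_rel (LAdd t u) (LAdd t' u')
| lpa_scale c t t' : lpa_rel t t' -> lpa_rel (LScale c t) (LScale c t')
| lpa_mul t t' u u' :
    lpa_rel t t' -> lpa_rel u u' -> lpa_rel (LMul t u) (LMul t' u')
| lpa_addA t u v : lpa_rel (LAdd t (LAdd u v)) (LAdd (LAdd t u) v)
| lpa_addC t u : lpa_rel (LAdd t u) (LAdd u t)
| lpa_add0 t : lpa_rel (LAdd LZero t) t
| lpa_addN t : lpa_rel (LAdd (LOpp t) t) LZero
| lpa_scaleA c d t : lpa_rel (LScale c (LScale d t)) (LScale (c * d) t)
| lpa_scale1 t : lpa_rel (LScale 1 t) t
| lpa_scaleDr c t u :
    lpa_rel (LScale c (LAdd t u)) (LAdd (LScale c t) (LScale c u))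
| lpa_scaleDl c d t :
    lpa_rel (LScale (c + d) t) (LAdd (LScale c t) (LScale d t))
| lpa_mulA t u v : lpa_rel (LMul t (LMul u v)) (LMul (LMul t u) v)
| lpa_mulDl t u v : lpa_rel (LMul (LAdd t u) v) (LAdd (LMul t v) (LMul u v))
| lpa_mulDr t u v : lpa_rel (LMul t (LAdd u v)) (LAdd (LMul t u) (LMul t v))
| lpa_scaleAl c t u : lpa_rel (LScale c (LMul t u)) (LMul (LScale c t) u)
| lpa_scaleAr c t u : lpa_rel (LScale c (LMul t u)) (LMul t (LScale c u))
| lpa_vertex i j :
    lpa_rel (LMul (LVertex i) (LVertex j)) (if i == j then LVertex i else LZero)
| lpa_src (a : arrow (double_quiver E)) :
    lpa_rel (LMul (LVertex (src a)) (LArrow a)) (LArrow a)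
| lpa_rng (a : arrow (double_quiver E)) :
    lpa_rel (LMul (LArrow a) (LVertex (rng a))) (LArrow a)
| lpa_CK1 (a b : arrow E) :
    lpa_rel (LMul (LArrow (inr a)) (LArrow (inl b)))
            (if a == b then LVertex (rng a) else LZero)
| lpa_CK2 (i : vertex E) : ~~ sink i ->
    lpa_rel (LVertex i)
            (\big[LAdd/LZero]_(a : arrow E | src a == i)
               LMul (LArrow (inl a)) (LArrow (inr a))).

HB.instance Definition _ := gen_eqMixin lpa_term.
HB.instance Definition _ := gen_choiceMixin lpa_term.

Definition lpa_relb : rel lpa_term := fun t u => `[< lpa_rel t u >].

Fact lpa_relb_refl : reflexive lpa_relb.
Proof. by move=> t; apply/asboolP; apply: lpa_refl. Qed.

Fact lpa_relb_sym : symmetric lpa_relb.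
Proof. by move=> t u; apply/asboolP/asboolP; apply: lpa_sym. Qed.

Fact lpa_relb_trans : transitive lpa_relb.
Proof.
by move=> u t v /asboolP tu /asboolP uv; apply/asboolP; apply: lpa_trans uv.
Qed.

Definition lpa_equiv :=
  EquivRel lpa_relb lpa_relb_refl lpa_relb_sym lpa_relb_trans.

Definition leavitt : Type := {eq_quot lpa_equiv}.
HB.instance Definition _ := Choice.on leavitt.
HB.instance Definition _ := Quotient.on leavitt.

Lemma leavittP t u : \pi_leavitt t = \pi_leavitt u <-> lpa_rel t u.
Proof.
split=> [/eqquotP|tu]; first by move/asboolP.
by apply/eqquotP; apply/asboolP.
Qed.

Let zeroq : leavitt := \pi_leavitt LZero.
Let oppq (x : leavitt) : leavitt := \pi_leavitt (LOpp (repr x)).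
Let addq (x y : leavitt) : leavitt := \pi_leavitt (LAdd (repr x) (repr y)).
Definition lpa_mulq (x y : leavitt) : leavitt := \pi_leavitt (LMul (repr x) (repr y)).
Definition lpa_scaleq (c : k) (x : leavitt) : leavitt := \pi_leavitt (LScale c (repr x)).

Let repr_lpa t : lpa_rel (repr (\pi_leavitt t)) t.
Proof. by apply/leavittP; rewrite reprK. Qed.

Let addqE t u : addq (\pi_leavitt t) (\pi_leavitt u) = \pi_leavitt (LAdd t u).
Proof. by apply/leavittP/lpa_add; apply: repr_lpa. Qed.

Let oppqE t : oppq (\pi_leavitt t) = \pi_leavitt (LOpp t).
Proof. by apply/leavittP/lpa_opp; apply: repr_lpa. Qed.

Let mulqE t u : lpa_mulq (\pi_leavitt t) (\pi_leavitt u) = \pi_leavitt (LMul t u).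
Proof. by apply/leavittP/lpa_mul; apply: repr_lpa. Qed.

Let scaleqE c t : lpa_scaleq c (\pi_leavitt t) = \pi_leavitt (LScale c t).
Proof. by apply/leavittP/lpa_scale; apply: repr_lpa. Qed.

Let addqA : associative addq.
Proof.
elim/quotW=> t; elim/quotW=> u; elim/quotW=> v; rewrite (addqE u v) (addqE t u) !addqE.
exact/leavittP/lpa_addA.
Qed.

Let addqC : commutative addq.
Proof.
by elim/quotW=> t; elim/quotW=> u; rewrite (addqE t) (addqE u); apply/leavittP/lpa_addC.
Qed.

Let add0q : left_id zeroq addq.
Proof. by elim/quotW=> t; rewrite addqE; apply/leavittP/lpa_add0. Qed.

Let addNq : left_inverse zeroq oppq addq.
Proof. by elim/quotW=> t; rewrite oppqE addqE; apply/leavittP/lpa_addN. Qed.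

HB.instance Definition _ :=
  GRing.isZmodule.Build leavitt addqA addqC add0q addNq.

Definition lpa_vtx (i : vertex E) : leavitt := \pi_leavitt (LVertex i).
Definition lpa_arr (a : arrow (double_quiver E)) : leavitt := \pi_leavitt (LArrow a).
Definition lpa_one : leavitt := \sum_(i : vertex E) lpa_vtx i.

Let piD t u : \pi_leavitt (LAdd t u) = \pi_leavitt t + \pi_leavitt u.
Proof. by rewrite [RHS]addqE. Qed.

Let piN t : \pi_leavitt (LOpp t) = - \pi_leavitt t.
Proof. by rewrite [RHS]oppqE. Qed.

Let mulqA : associative lpa_mulq.
Proof.
elim/quotW=> t; elim/quotW=> u; elim/quotW=> v; rewrite (mulqE u v) (mulqE t u) !mulqE.
exact/leavittP/lpa_mulA.
Qed.

Let mulqDl : left_distributive lpa_mulq +%R.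
Proof.
elim/quotW=> t; elim/quotW=> u; elim/quotW=> v.
by rewrite -(piD t u) !mulqE -piD; apply/leavittP/lpa_mulDl.
Qed.

Let mulqDr : right_distributive lpa_mulq +%R.
Proof.
elim/quotW=> t; elim/quotW=> u; elim/quotW=> v.
by rewrite -(piD u v) !mulqE -piD; apply/leavittP/lpa_mulDr.
Qed.

Let mul0q x : lpa_mulq 0 x = 0.
Proof. by apply: (addrI (lpa_mulq 0 x)); rewrite -mulqDl !addr0. Qed.

Let mulq0 x : lpa_mulq x 0 = 0.
Proof. by apply: (addrI (lpa_mulq x 0)); rewrite -mulqDr !addr0. Qed.

Let mulqN x y : lpa_mulq x (- y) = - lpa_mulq x y.
Proof. by apply: (addrI (lpa_mulq x y)); rewrite -mulqDr !subrr mulq0. Qed.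

Let mulNq x y : lpa_mulq (- x) y = - lpa_mulq x y.
Proof. by apply: (addrI (lpa_mulq x y)); rewrite -mulqDl !subrr mul0q. Qed.

Let scaleqAl c x y : lpa_scaleq c (lpa_mulq x y) = lpa_mulq (lpa_scaleq c x) y.
Proof.
elim/quotW: x => t; elim/quotW: y => u.
rewrite (mulqE t) (scaleqE c t) mulqE scaleqE.
exact/leavittP/lpa_scaleAl.
Qed.

Let scaleqAr c x y : lpa_scaleq c (lpa_mulq x y) = lpa_mulq x (lpa_scaleq c y).
Proof.
elim/quotW: x => t; elim/quotW: y => u.
rewrite (mulqE t) (scaleqE c u) mulqE scaleqE.
exact/leavittP/lpa_scaleAr.
Qed.

Let vtxM i j : lpa_mulq (lpa_vtx i) (lpa_vtx j) = if i == j then lpa_vtx i else 0.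
Proof.
rewrite mulqE; have /leavittP -> := lpa_vertex i j.
by case: (i == j).
Qed.

Let srcM (a : arrow (double_quiver E)) : lpa_mulq (lpa_vtx (src a)) (lpa_arr a) = lpa_arr a.
Proof. by rewrite mulqE; apply/leavittP/lpa_src. Qed.

Let rngM (a : arrow (double_quiver E)) : lpa_mulq (lpa_arr a) (lpa_vtx (rng a)) = lpa_arr a.
Proof. by rewrite mulqE; apply/leavittP/lpa_rng. Qed.

Let oneM_vtx j : lpa_mulq lpa_one (lpa_vtx j) = lpa_vtx j.
Proof.
rewrite /lpa_one (big_morph (lpa_mulq^~ _) (fun x y => mulqDl x y _) (mul0q _)).
rewrite (bigD1 j) //= big1 ?addr0 => [|i /negPf ij]; rewrite vtxM ?eqxx //.
by rewrite ij.
Qed.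

Let Mone_vtx j : lpa_mulq (lpa_vtx j) lpa_one = lpa_vtx j.
Proof.
rewrite /lpa_one (big_morph (lpa_mulq _) (mulqDr _) (mulq0 _)).
rewrite (bigD1 j) //= big1 ?addr0 => [|i /negPf ij]; rewrite vtxM ?eqxx //.
by rewrite eq_sym ij.
Qed.

Let mul1q : left_id lpa_one lpa_mulq.
Proof.
elim/quotW; elim=> [i|a||t IHt|t IHt u IHu|c t IHt|t IHt u IHu].
- exact: oneM_vtx.
- by rewrite -[\pi_leavitt _]/(lpa_arr a) -srcM mulqA oneM_vtx.
- exact: mulq0.
- by rewrite piN mulqN IHt.
- by rewrite piD mulqDr IHt IHu.
- by rewrite -scaleqE -scaleqAr IHt.
- by rewrite -mulqE mulqA IHt.
Qed.

Let mulq1 : right_id lpa_one lpa_mulq.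
Proof.
elim/quotW; elim=> [i|a||t IHt|t IHt u IHu|c t IHt|t IHt u IHu].
- exact: Mone_vtx.
- by rewrite -[\pi_leavitt _]/(lpa_arr a) -rngM -mulqA Mone_vtx.
- exact: mul0q.
- by rewrite piN mulNq IHt.
- by rewrite piD mulqDl IHt IHu.
- by rewrite -scaleqE -scaleqAl IHt.
- by rewrite -mulqE -mulqA IHu.
Qed.

HB.instance Definition _ :=
  GRing.Zmodule_isPzRing.Build leavitt mulqA mul1q mulq1 mulqDl mulqDr.

Definition lpa_scal (c : k) : leavitt := lpa_scaleq c 1.

Let scaleqE1 c x : lpa_scaleq c x = lpa_scal c * x.
Proof. by rewrite [RHS](esym (scaleqAl c 1 x)) (mul1q x). Qed.

Fact lpa_scal1 : lpa_scal 1 = 1.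
Proof.
rewrite /lpa_scal; elim/quotW: (1 : leavitt) => t.
by rewrite scaleqE; apply/leavittP/lpa_scale1.
Qed.

Fact lpa_scalD c d : lpa_scal (c + d) = lpa_scal c + lpa_scal d.
Proof.
rewrite /lpa_scal; elim/quotW: (1 : leavitt) => t.
by rewrite !scaleqE -piD; apply/leavittP/lpa_scaleDl.
Qed.

Fact lpa_scalM c d : lpa_scal (c * d) = lpa_scal c * lpa_scal d.
Proof.
rewrite -scaleqE1 /lpa_scal; elim/quotW: (1 : leavitt) => t.
by rewrite (scaleqE d) !scaleqE; apply/esym/leavittP/lpa_scaleA.
Qed.

Fact lpa_scalC c x : lpa_scal c * x = x * lpa_scal c.
Proof. by rewrite -scaleqE1 [RHS](esym (scaleqAr c x 1)) (mulq1 x). Qed.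

HB.instance Definition _ :=
  PzRing_isKAlgebra.Build k leavitt lpa_scal1 lpa_scalD lpa_scalM lpa_scalC.

Lemma leavitt_piD t u : \pi_leavitt (LAdd t u) = \pi_leavitt t + \pi_leavitt u.
Proof. exact: piD. Qed.

Lemma leavitt_piN t : \pi_leavitt (LOpp t) = - \pi_leavitt t.
Proof. exact: piN. Qed.

Lemma leavitt_piM t u : \pi_leavitt (LMul t u) = \pi_leavitt t * \pi_leavitt u.
Proof. exact/esym/mulqE. Qed.

Lemma leavitt_piZ c t : \pi_leavitt (LScale c t) = scal c * \pi_leavitt t.
Proof. by rewrite -scaleqE scaleqE1. Qed.

Lemma leavitt_oneE : 1 = \sum_(i : vertex E) lpa_vtx i :> leavitt.
Proof. by []. Qed.

End Leavitt.

(* Main.v *)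
Require Import Defs.
From mathcomp Require Import all_boot all_algebra.
From mathcomp Require Import zify boolp classical_sets functions.

(** The number of tensor factors is detected by homological dimension. An
    n-fold tensor product A of Leavitt path algebras has dimension at most n,
    whereas an m-fold tensor product B of Leavitt path algebras of quivers
    with a closed path has dimension at least m; since the dimension depends
    only on the module category, a Morita equivalence between A and B forces m
    <= n, and by symmetry m = n.

    Upper bound. L = L(E) is quasi-free: a derivation of L that kills the
    vertices can be prescribed on the arrows of E, subject only to their
    sources and ranges, and is determined by its values there
    ([derivation_exists], [derivation_eq0]). Let K be a complex of L-modules
    that are projective relative to k, and h a k-linear contracting homotopy
    of K, made linear over the vertices. The derivation l |-> [l, h] measures
    the failure of h to be L-linear. The derivation D with D(a) = [a, h] h on
    arrows a exhibits it, up to sign, as the commutator of d with D, and h can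
    then be corrected into an L-linear homotopy, at the price of one degree:
    the new homotopy contracts K only from one degree further up
    ([leavitt_homotopyP], [dim_le_leavitt]). The correction preserves
    linearity over any algebra that commutes with L, so that the prices add up
    in a tensor product ([dim_le_tensor]).

    Lower bound. If c is a closed path then right multiplication by x = 1 - c
    is injective on L(E), because c raises the degree of the grading by path
    length ([path_elt_not_right_zero_divisor]); over a field it therefore has
    a linear retraction ([linear_retraction]). Still x has no right inverse:
    some linear functional lam has lam (x b) = 0 for all b and lam 1 = 1
    ([evaluation_functional]). In B this gives m commuting elements x_j, one
    for each factor, with compatible retractions and a functional vanishing on
    the right ideal that they generate ([tensor_split_sequence]).

    Comparison. Let P be a bimodule implementing a Morita equivalence between
    A and B. The elements x_j act on P from the right by endomorphisms of the
    left A-module P. The Koszul complex of these endomorphisms is contractible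
    over k in positive degrees ([kos_homotopy]), because P is a direct summand
    of a sum of copies of B. If n < m, then the upper bound makes its last
    differential A-linearly split: there are A-endomorphisms G_j of P with
    sum_j G_j (p x_j) = p for all p ([kos_d_top]). As G_j is right
    multiplication by some b_j in B ([morita_invertible]), sum_j x_j b_j = 1,
    which lam contradicts ([dim_le_split_sequence]). *)

Set Implicit Arguments.
Unset Strict Implicit.
Unset Printing Implicit Defensive.

Import GRing.Theory.
Local Open Scope ring_scope.
Local Open Scope quotient_scope.

(** * Additive maps and scalars *)

Section AdditiveMaps.
Variables (U V : zmodType) (f : U -> V).
Hypothesis fD : {morph f : x y / x + y}.

Lemma addm0 : f 0 = 0.
Proof. by apply: (addrI (f 0)); rewrite -fD !addr0. Qed.

Lemma addmN : {morph f : x / - x}.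
Proof. by move=> x; apply: (addrI (f x)); rewrite -fD !subrr addm0. Qed.

Lemma addmB : {morph f : x y / x - y}.
Proof. by move=> x y; rewrite fD addmN. Qed.

Lemma addm_sum (I : Type) (r : seq I) (P : pred I) (F : I -> U) :
  f (\sum_(i <- r | P i) F i) = \sum_(i <- r | P i) f (F i).
Proof. exact: (big_morph f fD addm0). Qed.

End AdditiveMaps.

Lemma scalN (k : fieldType) (A : kalgType k) (c : k) : scal (- c) = - scal c :> A.
Proof. exact: (addmN (@scalD k A)). Qed.

Lemma scal0 (k : fieldType) (A : kalgType k) : scal (0 : k) = 0 :> A.
Proof. exact: (addm0 (@scalD k A)). Qed.

(** * Presentation and representations of Leavitt path algebras *)

Section LeavittBasics.
Variables (k : fieldType) (E : quiver).
Local Notation L := (leavitt k E).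
Local Notation vtx := (@lpa_vtx k E).
Local Notation arr := (@lpa_arr k E).

Lemma vtxM i j : vtx i * vtx j = if i == j then vtx i else 0 :> L.
Proof.
rewrite /lpa_vtx -leavitt_piM; have /leavittP -> := lpa_vertex k i j.
by case: ifP.
Qed.

Lemma vtx_arr (a : arrow (double_quiver E)) : vtx (@src (double_quiver E) a) * arr a = arr a.
Proof. by rewrite /lpa_vtx -leavitt_piM; apply/leavittP/lpa_src. Qed.

Lemma arr_vtx (a : arrow (double_quiver E)) : arr a * vtx (@rng (double_quiver E) a) = arr a.
Proof. by rewrite /lpa_vtx -leavitt_piM; apply/leavittP/lpa_rng. Qed.

Lemma ghost_arr a b :
  arr (inr a) * arr (inl b) = if a == b then vtx (rng a) else 0.
Proof.
rewrite /lpa_arr -leavitt_piM; have /leavittP -> := lpa_CK1 k a b.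
by case: ifP.
Qed.

Lemma arr_ghost_sum (i : vertex E) : ~~ sink i ->
  vtx i = \sum_(a : arrow E | src a == i) arr (inl a) * arr (inr a).
Proof.
move=> /(lpa_CK2 k)/leavittP.
rewrite -[LHS]/(vtx i) => ->.
rewrite (big_morph _ (@leavitt_piD k E) (erefl 0)).
by apply: eq_bigr => a _; rewrite leavitt_piM.
Qed.

Lemma sum_vtx : \sum_(i : vertex E) vtx i = 1 :> L.
Proof. by rewrite leavitt_oneE. Qed.

Lemma leavitt_ind (K : L -> Prop) :
  K 0 -> (forall i, K (vtx i)) -> (forall a, K (arr a)) ->
  (forall x y, K x -> K y -> K (x + y)) ->
  (forall c x, K x -> K (scal c * x)) ->
  (forall x y, K x -> K y -> K (x * y)) -> forall x, K x.
Proof.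
move=> K0 Kv Ka KD KZ KM; elim/quotW.
elim=> [i|a||t IHt|t IHt u IHu|c t IHt|t IHt u IHu] //.
- exact: Kv.
- exact: Ka.
- by rewrite leavitt_piN -mulN1r -(@scal1 k L) -scalN; apply: KZ.
- by rewrite leavitt_piD; apply: KD.
- by rewrite leavitt_piZ; apply: KZ.
- by rewrite leavitt_piM; apply: KM.
Qed.

End LeavittBasics.

Section LeavittRepresentation.
Variables (k : fieldType) (E : quiver) (V : zmodType).
Variables (sc : k -> V -> V) (pv : vertex E -> V -> V).
Variables (pa : arrow (double_quiver E) -> V -> V).
Local Notation L := (leavitt k E).

Hypothesis scD : forall c, {morph sc c : x y / x + y}.
Hypothesis sc1 : forall x, sc 1 x = x.
Hypothesis scDl : forall c d x, sc (c + d) x = sc c x + sc d x.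
Hypothesis scM : forall c d x, sc (c * d) x = sc c (sc d x).
Hypothesis pvD : forall i, {morph pv i : x y / x + y}.
Hypothesis paD : forall a, {morph pa a : x y / x + y}.
Hypothesis pvZ : forall i c x, pv i (sc c x) = sc c (pv i x).
Hypothesis paZ : forall a c x, pa a (sc c x) = sc c (pa a x).
Hypothesis pvM : forall i j x, pv i (pv j x) = if i == j then pv i x else 0.
Hypothesis pv_pa : forall a x, pv (@src (double_quiver E) a) (pa a x) = pa a x.
Hypothesis pa_pv : forall a x, pa a (pv (@rng (double_quiver E) a) x) = pa a x.
Hypothesis pa_CK1 : forall a b x,
  pa (inr a) (pa (inl b) x) = if a == b then pv (rng a) x else 0.
Hypothesis pa_CK2 : forall i x, ~~ sink i ->
  pv i x = \sum_(a : arrow E | src a == i) pa (inl a) (pa (inr a) x).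

Fixpoint lpa_eval (t : lpa_term k E) : V -> V :=
  match t with
  | LVertex i => pv i
  | LArrow a => pa a
  | LZero => fun=> 0
  | LOpp t => fun x => - lpa_eval t x
  | LAdd t u => fun x => lpa_eval t x + lpa_eval u x
  | LScale c t => fun x => sc c (lpa_eval t x)
  | LMul t u => fun x => lpa_eval t (lpa_eval u x)
  end.

Lemma lpa_evalD t : {morph lpa_eval t : x y / x + y}.
Proof.
elim: t => [i|a||t IHt|t IHt u IHu|c t IHt|t IHt u IHu] x y //=.
- exact: pvD.
- exact: paD.
- by rewrite addr0.
- by rewrite IHt opprD.
- by rewrite IHt IHu addrACA.
- by rewrite IHt scD.
- by rewrite IHu IHt.
Qed.

Lemma lpa_evalZ t c x : lpa_eval t (sc c x) = sc c (lpa_eval t x).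
Proof.
elim: t x => [i|a||t IHt|t IHt u IHu|d t IHt|t IHt u IHu] x //=.
- by rewrite (addm0 (@scD c)).
- by rewrite IHt (addmN (@scD c)).
- by rewrite IHt IHu scD.
- by rewrite IHt -!scM mulrC.
- by rewrite IHu IHt.
Qed.

(** The hypotheses on the operators are the defining relations, so each rule of
    the congruence [lpa_rel] holds for the operators as well. *)
Lemma lpa_evalP t u : lpa_rel t u -> lpa_eval t =1 lpa_eval u.
Proof.
elim=> {t u} //=.
- by move=> t u _ IH x; rewrite IH.
- by move=> t u v _ IH1 _ IH2 x; rewrite IH1.
- by move=> t t' _ IH x; rewrite IH.
- by move=> t t' u u' _ IH1 _ IH2 x; rewrite IH1 IH2.
- by move=> c t t' _ IH x; rewrite IH.
- by move=> t t' u u' _ IH1 _ IH2 x; rewrite IH1 IH2.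
- by move=> t u v x; rewrite addrA.
- by move=> t u x; rewrite addrC.
- by move=> t x; rewrite add0r.
- by move=> t x; rewrite addNr.
- by move=> c d t x; rewrite scM.
- by move=> t x; rewrite sc1.
- by move=> c t u x; rewrite scD.
- by move=> c d t x; rewrite scDl.
- by move=> t u v x; rewrite lpa_evalD.
- by move=> c t u x; rewrite lpa_evalZ.
- by move=> i j x; rewrite pvM; case: ifP.
- by move=> a b x; rewrite pa_CK1; case: ifP.
- move=> i iE x; rewrite pa_CK2 //.
  by rewrite (big_morph (lpa_eval^~ x) (id1 := 0) (op1 := +%R)).
Qed.

(** Universal property of the presentation: to let L(E) act it suffices to let
    the generators act compatibly with the relations.  The module [V] need not
    be unital. *)
Lemma leavitt_representation : exists act : L -> V -> V,
  [/\ (forall a b x, act (a + b) x = act a x + act b x),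
      (forall a, {morph act a : x y / x + y}),
      (forall a b x, act (a * b) x = act a (act b x)),
      (forall c a x, act (scal c * a) x = sc c (act a x)) &
      (forall i, act (lpa_vtx k i) =1 pv i) /\
      (forall a, act (lpa_arr k a) =1 pa a)].
Proof.
have evalE t : lpa_eval (repr (\pi_(leavitt k E) t)) =1 lpa_eval t.
  by apply: lpa_evalP; apply/leavittP; rewrite reprK.
exists (fun a => lpa_eval (repr a)); split=> [a b x|a x y|a b x|c a x|].
- elim/quotW: a => t; elim/quotW: b => u.
  by rewrite -leavitt_piD !evalE.
- exact: lpa_evalD.
- elim/quotW: a => t; elim/quotW: b => u.
  by rewrite -leavitt_piM !evalE.
- by elim/quotW: a => t; rewrite -leavitt_piZ !evalE.
- by split=> a x; rewrite evalE.
Qed.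

End LeavittRepresentation.

(** * Derivations of Leavitt path algebras *)

Record kalg_hom (k : fieldType) (A R : kalgType k) (f : A -> R) : Prop := KalgHom {
  homD : {morph f : x y / x + y};
  homM : {morph f : x y / x * y};
  hom1 : f 1 = 1;
  homZ : forall c, f (scal c) = scal c }.

Section LeavittDerivations.
Variables (k : fieldType) (E : quiver).
Local Notation L := (leavitt k E).
Local Notation vtx := (@lpa_vtx k E).
Local Notation arr := (@lpa_arr k E).
Variables (R : kalgType k) (iota : L -> R).
Hypothesis iotaP : kalg_hom iota.
Variables K K' : lmodType R.

Let iD := homD iotaP.
Let iM := homM iotaP.

(** A derivation, relative to k and the vertices, from L(E) to the bimodule of
    additive maps from [K] to [K']. *)
Record derivation (D : L -> K -> K') : Prop := Derivation {
  derDl : forall l m x, D (l + m) x = D l x + D m x;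
  derDr : forall l, {morph D l : x y / x + y};
  derM : forall l m x, D (l * m) x = iota l *: D m x + D l (iota m *: x);
  derZ : forall c x, D (scal c) x = 0;
  der_vtx : forall i x, D (vtx i) x = 0 }.

Lemma derivationB (D D' : L -> K -> K') :
  derivation D -> derivation D' -> derivation (fun l x => D l x - D' l x).
Proof.
move=> [Dl Dr M Z v] [Dl' Dr' M' Z' v'].
split=> [l m x|l x y|l m x|c x|i x].
- by rewrite Dl Dl' opprD addrACA.
- by rewrite Dr Dr' opprD addrACA.
- by rewrite M M' opprD addrACA -scalerBr.
- by rewrite Z Z' subrr.
- by rewrite v v' subrr.
Qed.

Lemma inner_derivation (h : K -> K') : {morph h : x y / x + y} ->
  (forall c x, h ((scal c : R) *: x) = (scal c : R) *: h x) ->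
  (forall i x, h (iota (vtx i) *: x) = iota (vtx i) *: h x) ->
  derivation (fun l x => iota l *: h x - h (iota l *: x)).
Proof.
move=> hD hZ hv; split=> [l m x|l x y|l m x|c x|i x].
- by rewrite iD !scalerDl hD opprD addrACA.
- by rewrite hD !scalerDr hD opprD addrACA.
- by rewrite iM -!scalerA scalerBr addrA subrK.
- by rewrite (homZ iotaP) hZ subrr.
- by rewrite hv subrr.
Qed.

(** The ghost arrow of [a] is a sum of products (a^* b) b^* over the arrows b
    starting at the source of [a], and a derivation killing b kills (D a^* ) b,
    because a^* b is a vertex or zero. *)
Lemma derivation_eq0 (D : L -> K -> K') : derivation D ->
  (forall a x, D (arr (inl a)) x = 0) -> forall l x, D l x = 0.
Proof.
move=> [DDl DDr DM DZ Dv] Da.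
elim/leavitt_ind => [x|i x|[a|a] x|l m IHl IHm x|c l IHl x|l m IHl IHm x].
- exact: (addm0 (f := D^~ x) (fun l m => DDl l m x)).
- exact: Dv.
- exact: Da.
- have sN : ~~ sink (src a) by apply/forallPn; exists a; rewrite negbK.
  rewrite -(arr_vtx k (inr a)) DM [in D (vtx _)]/= Dv scaler0 add0r.
  rewrite [@rng _ _]/= (arr_ghost_sum k sN) (addm_sum iD) scaler_suml.
  rewrite (addm_sum (DDr _)) big1 // => b _; rewrite iM -scalerA.
  set z := _ *: x; apply: (addrI (iota (arr (inr a)) *: D (arr (inl b)) z)).
  rewrite -DM ghost_arr Da scaler0 add0r; case: ifP => _; first exact: Dv.
  exact: (addm0 (f := D^~ z) (fun l m => DDl l m z)).
- by rewrite DDl IHl IHm addr0.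
- by rewrite DM IHl DZ scaler0 addr0.
- by rewrite DM IHl IHm scaler0 addr0.
Qed.

(** Quasi-freeness of L(E).  A derivation D from [K] to [K'] amounts to an
    action of L(E) on [K' * K] by triangular operators, with D in the corner.
    The relation a^* b = delta_(a,b) forces
    D a^* = - sum_b a^* (D b) b^*, and with this value the defining relations
    hold for the triangular operators. *)
Lemma derivation_exists (u : arrow E -> K -> K') :
  (forall a, {morph u a : x y / x + y}) ->
  (forall a c x, u a ((scal c : R) *: x) = (scal c : R) *: u a x) ->
  (forall a x, iota (vtx (src a)) *: u a x = u a x) ->
  (forall a x, u a (iota (vtx (rng a)) *: x) = u a x) ->
  exists2 D : L -> K -> K', derivation D & forall a x, D (arr (inl a)) x = u a x.
Proof.
move=> uD uZ us ur.
have i0 : iota 0 = 0 by exact: addm0.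
have v_v i j (V : lmodType R) (x : V) :
    iota (vtx i) *: (iota (vtx j) *: x) = if i == j then iota (vtx i) *: x else 0.
  by rewrite scalerA -iM vtxM; case: ifP; rewrite // i0 scale0r.
have v_a a (V : lmodType R) (x : V) :
    iota (vtx (@src (double_quiver E) a)) *: (iota (arr a) *: x) = iota (arr a) *: x.
  by rewrite scalerA -iM vtx_arr.
have a_v a (V : lmodType R) (x : V) :
    iota (arr a) *: (iota (vtx (@rng (double_quiver E) a)) *: x) = iota (arr a) *: x.
  by rewrite scalerA -iM arr_vtx.
have g_a a b (V : lmodType R) (x : V) :
    iota (arr (inr a)) *: (iota (arr (inl b)) *: x) =
    if a == b then iota (vtx (rng a)) *: x else 0.
  by rewrite scalerA -iM ghost_arr; case: ifP; rewrite // i0 scale0r.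
have CK2 i (V : lmodType R) (x : V) : ~~ sink i -> iota (vtx i) *: x =
    \sum_(a | src a == i) iota (arr (inl a)) *: (iota (arr (inr a)) *: x).
  move=> iN; rewrite (arr_ghost_sum k iN) (addm_sum iD) scaler_suml.
  by apply: eq_bigr => a _; rewrite iM scalerA.
have scC c (r : R) (V : lmodType R) (x : V) :
   r *: ((scal c : R) *: x) = (scal c : R) *: (r *: x).
  by rewrite !scalerA scalC.
pose V : zmodType := (K' * K)%type.
pose sc (c : k) (v : V) : V := ((scal c : R) *: v.1, (scal c : R) *: v.2).
pose pv i (v : V) : V := (iota (vtx i) *: v.1, iota (vtx i) *: v.2).
pose w (a : arrow (double_quiver E)) (x : K) : K' :=
  match a with
  | inl a => u a x
  | inr a => - \sum_(b | src b == src a)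
      iota (arr (inr a)) *: u b (iota (arr (inr b)) *: x)
  end.
pose pa a (v : V) : V := (iota (arr a) *: v.1 + w a v.2, iota (arr a) *: v.2).
have wD a : {morph w a : x y / x + y}.
  case: a => a x y /=; first exact: uD.
  rewrite -opprD -big_split /=; congr (- _); apply: eq_bigr => b _.
  by rewrite scalerDr uD scalerDr.
have w0 a : w a 0 = 0 by apply: addm0.
have wZ a c x : w a ((scal c : R) *: x) = (scal c : R) *: w a x.
  case: a => a /=; first exact: uZ.
  rewrite scalerN scaler_sumr; congr (- _); apply: eq_bigr => b _.
  by rewrite scC uZ scC.
have [|||||||||||||act [aDl aDr aM aZ [av aa]]] :=
  @leavitt_representation k E V sc pv pa.
- by move=> c [x y] [x' y']; congr (_, _) => /=; rewrite scalerDr.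
- by move=> [x y]; congr (_, _) => /=; rewrite scal1 scale1r.
- by move=> c d [x y]; congr (_, _) => /=; rewrite scalD scalerDl.
- by move=> c d [x y]; congr (_, _) => /=; rewrite scalM scalerA.
- by move=> c [x y] [x' y']; congr (_, _) => /=; rewrite scalerDr.
- move=> a [x y] [x' y']; congr (_, _) => /=; rewrite scalerDr // wD.
  by rewrite addrACA.
- by move=> i c [x y]; congr (_, _) => /=; rewrite scC.
- by move=> a c [x y]; congr (_, _) => /=; rewrite scC // wZ scalerDr.
- move=> i j [x y]; rewrite /pv /= !v_v; case: ifP => // _.
- move=> a [x y]; rewrite /pv /pa /= scalerDr !v_a; congr (_ + _, _).
  case: a => a /=; first exact: us.
  rewrite scalerN scaler_sumr; congr (- _); apply: eq_bigr => b _.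
  exact: (v_a (inr a)).
- move=> a [x y]; rewrite /pv /pa /= !a_v; congr (_ + _, _).
  case: a => a /=; first exact: ur.
  congr (- _); apply: eq_bigr => b /eqP sb.
  by rewrite -[in LHS]sb (a_v (inr b)).
- move=> a b [x y]; rewrite /pv /pa /= scalerDr !g_a -addrA.
  suff -> : iota (arr (inr a)) *: u b y
    - \sum_(c | src c == src a) iota (arr (inr a)) *:
         u c (iota (arr (inr c)) *: (iota (arr (inl b)) *: y)) = 0.
    by rewrite addr0; case: ifP.
  have [sab|/negPf sab] := eqVneq (src b) (src a).
    rewrite (bigD1 b) ?sab //= big1 => [|c /andP[_ /negPf cb]]; last first.
      by rewrite g_a cb (addm0 (uD c)) scaler0.
    by rewrite addr0 g_a eqxx ur subrr.
  rewrite big1 => [|c /eqP sca]; last first.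
    rewrite g_a; case: eqP => [cb|_]; last by rewrite (addm0 (uD c)) scaler0.
    by rewrite -sca cb eqxx in sab.
  rewrite subr0 -[in LHS]us -[in LHS](a_v (inr a)) v_v /=.
  by rewrite eq_sym sab scaler0.
- move=> i [x y] iN.
  rewrite [RHS]surjective_pairing (big_morph fst (id1 := 0) (op1 := +%R)) //.
  rewrite (big_morph snd (id1 := 0) (op1 := +%R)) //.
  congr (_, _); last exact: CK2.
  rewrite /pa /=.
  under eq_bigr do rewrite scalerDr -addrA.
  rewrite big_split /= -CK2 // -[LHS]addr0; congr (_ + _).
  under eq_bigr do rewrite scalerN.
  rewrite big_split /= sumrN.
  apply/esym/eqP; rewrite addrC subr_eq0; apply/eqP/esym.
  transitivity (\sum_(a | src a == i) \sum_(b | src b == i) iota (arr (inl a)) *: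
      (iota (arr (inr a)) *: u b (iota (arr (inr b)) *: y))).
    apply: eq_bigr => a /eqP sa; rewrite scaler_sumr.
    by apply: eq_bigl => b; rewrite sa.
  rewrite exchange_big /=; apply: eq_bigr => b /eqP sb.
  by rewrite -CK2 // -[in iota (vtx i)]sb us.
have act0 l : act l 0 = 0 by apply: addm0 (aDr l).
have actE l : exists f : K -> K', forall v, act l v = (iota l *: v.1 + f v.2, iota l *: v.2).
  elim/leavitt_ind: l => [|i|a|l m [f fE] [g gE]|c l [f fE]|l m [f fE] [g gE]].
  - exists (fun=> 0) => v; rewrite i0 !scale0r addr0.
    exact: (addm0 (f := act^~ v) (fun a b => aDl a b v)).
  - by exists (fun=> 0) => v; rewrite av addr0.
  - by exists (w a) => v; rewrite aa.
  - exists (fun x => f x + g x) => v.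
    by rewrite aDl fE gE iD !scalerDl addrACA.
  - exists (fun x => (scal c : R) *: f x) => v.
    by rewrite aZ fE /sc /= scalerDr iM (homZ iotaP) !scalerA.
  - exists (fun x => iota l *: g x + f (iota m *: x)) => v.
    by rewrite aM gE fE /= scalerDr iM !scalerA addrA.
pose D l x : K' := (act l (0, x)).1.
have DE l v : act l v = (iota l *: v.1 + D l v.2, iota l *: v.2).
  by have [f fE] := actE l; rewrite /D !fE /= scaler0 add0r.
have Dv i x : D (vtx i) x = 0 by rewrite /D av /= scaler0.
have DDl l m x : D (l + m) x = D l x + D m x by rewrite /D aDl.
have DDr l : {morph D l : x y / x + y}.
  move=> x y; rewrite /D; have -> : (0, x + y) = (0, x) + (0, y) :> V.
    by congr (_, _); rewrite /= addr0.
  by rewrite aDr.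
exists D => [|a x]; last by rewrite /D aa /= scaler0 add0r.
split=> // [l m x|c x]; first by rewrite {1}/D aM (DE m) (DE l) /= scaler0 add0r.
rewrite -[scal c]mulr1 /D aZ /= -sum_vtx.
rewrite (big_morph (act^~ (0, x)) (id1 := 0) (op1 := +%R)) => [|l m|]; first last.
- exact: (addm0 (f := act^~ _) (fun a b => aDl a b _)).
- exact: aDl.
rewrite (big_morph fst (id1 := 0) (op1 := +%R)) // big1 ?scaler0 // => i _.
exact: Dv.
Qed.

End LeavittDerivations.

Lemma derivation_comp (k : fieldType) (E : quiver) (R : kalgType k)
    (iota : leavitt k E -> R) (K1 K2 K3 K4 : lmodType R)
    (f : K1 -> K2) (g : K3 -> K4) (D : leavitt k E -> K2 -> K3) :
  {morph f : x y / x + y} -> (forall l x, f (iota l *: x) = iota l *: f x) ->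
  {morph g : x y / x + y} -> (forall l x, g (iota l *: x) = iota l *: g x) ->
  derivation iota D -> derivation iota (fun l x => g (D l (f x))).
Proof.
move=> fD fL gD gL [Dl Dr M Z v]; split=> [l m x|l x y|l m x|c x|i x].
- by rewrite Dl gD.
- by rewrite fD Dr gD.
- by rewrite M gD gL fL.
- by rewrite Z (addm0 gD).
- by rewrite v (addm0 gD).
Qed.

(** * Linear contractions of complexes of relatively projective modules *)

Section ContractionDimension.
Variable k : fieldType.

Record balanced (A R : kalgType k) (K : lmodType R) (G : zmodType)
    (phi : A -> K -> G) : Prop := Balanced {
  balDl : forall a b x, phi (a + b) x = phi a x + phi b x;
  balDr : forall a, {morph phi a : x y / x + y};
  balZ : forall a c x, phi (a * scal c) x = phi a ((scal c : R) *: x) }.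

(** A list of pairs stands for the corresponding element of the tensor product
    of [A] and [K] over k, on which a balanced map [phi] takes the value
    [ext phi z]. *)
Definition ext (A K : Type) (G : zmodType) (phi : A -> K -> G) (z : seq (A * K)) : G :=
  \sum_(u <- z) phi u.1 u.2.

(** [s] represents an [A]-linear and [T]-linear section of the action map from
    the tensor product of [A] and [K] over k to [K]; such a section exists when
    [K] is projective relative to k.  Equality in the tensor product is tested
    on balanced maps, which makes it unnecessary to equip the tensor product
    with its module structures. *)
Record splitting (A R : kalgType k) (iota : A -> R) (T : R -> Prop)
    (K : lmodType R) (s : K -> seq (A * K)) : Prop := Splitting {
  splD : forall (G : zmodType) (phi : A -> K -> G), balanced phi ->
    forall x y, ext phi (s (x + y)) = ext phi (s x) + ext phi (s y);
  splM : forall (G : zmodType) (phi : A -> K -> G), balanced phi ->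
    forall a x, ext phi (s (iota a *: x)) = ext (fun b => phi (a * b)) (s x);
  splT : forall (G : zmodType) (phi : A -> K -> G), balanced phi ->
    forall t x, T t -> ext phi (s (t *: x)) = ext (fun b y => phi b (t *: y)) (s x);
  splK : forall x, ext (fun a y => iota a *: y) (s x) = x }.

Record complex (R : pzRingType) (T : R -> Prop) (K : nat -> lmodType R)
    (d : forall i, K i.+1 -> K i) : Prop := Complex {
  cpxD : forall i, {morph d i : x y / x + y};
  cpxZ : forall i t x, T t -> d i (t *: x) = t *: d i x;
  cpx2 : forall i x, d i (d i.+1 x) = 0 }.

(** The homotopy contracts the complex in degrees greater than [r]; its
    components in lower degrees are unconstrained, except for linearity. *)
Record contraction (R : pzRingType) (T : R -> Prop) (K : nat -> lmodType R)
    (d : forall i, K i.+1 -> K i) (r : nat) (h : forall i, K i -> K i.+1) : Prop :=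
  Contraction {
  ctrD : forall i, {morph h i : x y / x + y};
  ctrZ : forall i t x, T t -> h i (t *: x) = t *: h i x;
  ctrE : forall i, (r <= i)%N -> forall x : K i.+1, h i (d i x) + d i.+1 (h i.+1 x) = x }.

Definition adjoin (A R : kalgType k) (T : R -> Prop) (iota : A -> R) : R -> Prop :=
  fun r => T r \/ exists a, r = iota a.

(** A form of the inequality: the projective dimension of [A] as a bimodule is
    at most [e].  Linear homotopies become [A]-linear at the price of [e]
    degrees.  The set [T] of operators commuting with [A], whose linearity is
    preserved, is what makes the property pass to tensor products: [T] will
    contain the other factors. *)
Definition dim_le (A : kalgType k) (e : nat) : Prop :=
  forall (R : kalgType k) (iota : A -> R) (T : R -> Prop) (K : nat -> lmodType R)
    (d : forall i, K i.+1 -> K i),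
  kalg_hom iota -> (forall t a, T t -> t * iota a = iota a * t) ->
  (forall c, T (scal c)) -> complex (adjoin T iota) d ->
  (forall i, exists s : K i -> seq (A * K i), splitting iota T s) ->
  forall r, (exists h, contraction T d r h) ->
  exists h, contraction (adjoin T iota) d (r + e) h.

Lemma splitting_sub (A R : kalgType k) (iota : A -> R) (T T' : R -> Prop)
    (K : lmodType R) (s : K -> seq (A * K)) :
  (forall t, T' t -> T t) -> splitting iota T s -> splitting iota T' s.
Proof.
move=> T'T [sD sM sT sK]; split=> // G phi phiP t x T't.
by apply: sT => //; apply: T'T.
Qed.

Lemma complex_sub (R : pzRingType) (T T' : R -> Prop) (K : nat -> lmodType R)
    (d : forall i, K i.+1 -> K i) :
  (forall t, T' t -> T t) -> complex T d -> complex T' d.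
Proof. by move=> T'T [dD dZ d2]; split=> // i t x /T'T; apply: dZ. Qed.

Section Ext.
Variables (A K : Type) (G : zmodType).
Implicit Types (phi psi : A -> K -> G).

Lemma ext_morph (H : zmodType) (f : G -> H) phi z : {morph f : x y / x + y} ->
  f (ext phi z) = ext (fun a x => f (phi a x)) z.
Proof. by move=> fD; rewrite /ext (addm_sum fD). Qed.

Lemma extD phi psi z : ext (fun a x => phi a x + psi a x) z = ext phi z + ext psi z.
Proof. by rewrite /ext big_split. Qed.

Lemma extB phi psi z : ext (fun a x => phi a x - psi a x) z = ext phi z - ext psi z.
Proof. by rewrite /ext sumrB. Qed.

Lemma eq_ext phi psi z : (forall a x, phi a x = psi a x) -> ext phi z = ext psi z.
Proof. by move=> e; apply: eq_bigr. Qed.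

End Ext.

Lemma balanced_mul (A R : kalgType k) (K : lmodType R) (G : zmodType)
  (phi : A -> K -> G) a : balanced phi -> balanced (fun b => phi (a * b)).
Proof.
move=> phiP; split=> [b c x|b x y|b c x].
- by rewrite mulrDr (balDl phiP).
- exact: (balDr phiP).
- by rewrite mulrA (balZ phiP).
Qed.

Lemma balanced_scale (A R : kalgType k) (K : lmodType R) (G : zmodType)
  (phi : A -> K -> G) t : balanced phi -> balanced (fun b y => phi b (t *: y)).
Proof.
move=> phiP; split=> [b c x|b x y|b c x].
- exact: (balDl phiP).
- by rewrite scalerDr (balDr phiP).
- by rewrite (balZ phiP) !scalerA scalC.
Qed.

Section TensorDimension.
Variables A B : kalgType k.

Lemma tensor_reprP (t : tensor A B) :
  exists z : seq (A * B), t = \sum_(u <- z) pure u.1 u.2.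
Proof.
elim/(@tensor_ind k A B): t => [a b|_ _ [z ->] [z' ->]].
  by exists [:: (a, b)]; rewrite big_seq1.
by exists (z ++ z'); rewrite big_cat.
Qed.

Definition tensor_repr (t : tensor A B) : seq (A * B) := sval (cid (tensor_reprP t)).

Lemma tensor_reprE t : \sum_(u <- tensor_repr t) pure u.1 u.2 = t.
Proof. exact/esym/(svalP (cid (tensor_reprP t))). Qed.

Lemma pure_homl : kalg_hom (fun a : A => pure a 1 : tensor A B).
Proof.
by split=> // [a a'|a a']; rewrite ?pureDl // pureM mulr1.
Qed.

Lemma pure_homr : kalg_hom (fun b : B => pure 1 b : tensor A B).
Proof.
split=> // [b b'|b b'|c]; rewrite ?pureDr ?pureM ?mulr1 //.
by rewrite -[X in pure 1 X]mulr1 -pure_bal mul1r.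
Qed.

End TensorDimension.

Lemma kalg_hom_comp (A B C : kalgType k) (f : A -> B) (g : B -> C) :
  kalg_hom f -> kalg_hom g -> kalg_hom (g \o f).
Proof.
move=> fP gP; split=> [x y|x y||c] /=.
- by rewrite (homD fP) (homD gP).
- by rewrite (homM fP) (homM gP).
- by rewrite (hom1 fP) (hom1 gP).
- by rewrite (homZ fP) (homZ gP).
Qed.

(** A section for [C] and a section of the regular [C]-module for [A] compose to
    a section for [A]. *)
Lemma splitting_trans (A C R : kalgType k) (j : A -> C) (iota : C -> R)
    (S : C -> Prop) (T : R -> Prop) (K : lmodType R)
    (s : K -> seq (C * K)) (e : C^o -> seq (A * C^o)) :
  kalg_hom j -> kalg_hom iota ->
  (forall t c, T t -> t * iota c = iota c * t) -> (forall c, T (scal c)) ->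
  (forall c, S (scal c)) -> splitting iota T s -> splitting j S e ->
  exists s' : K -> seq (A * K),
    splitting (iota \o j) (fun r => T r \/ exists2 c, S c & r = iota c) s'.
Proof.
move=> jP iP TC Tk Sk sP eP.
pose s' x := flatten [seq [seq (v.1, iota v.2 *: u.2) | v <- e u.1] | u <- s x].
pose lift (G : zmodType) (phi : A -> K -> G) (c : C) (x : K) :=
  ext (fun a (c' : C^o) => phi a (iota c' *: x)) (e c).
have s'E (G : zmodType) (phi : A -> K -> G) x : ext phi (s' x) = ext (lift G phi) (s x).
  rewrite /ext big_flatten big_map; apply: eq_bigr => u _.
  by rewrite big_map.
have regE (c : C) (c' : C^o) : c *: c' = c * c' by [].
have inner (G : zmodType) (phi : A -> K -> G) x : balanced phi ->
    balanced (fun a (c' : C^o) => phi a (iota c' *: x)).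
  move=> phiP; split=> [a b c|a c c'|a c c'].
  - exact: (balDl phiP).
  - by rewrite (homD iP) scalerDl (balDr phiP).
  - by rewrite (balZ phiP) (homM iP) (homZ iP) scalerA.
have liftP (G : zmodType) (phi : A -> K -> G) : balanced phi -> balanced (lift G phi).
  move=> phiP; split=> [c c' x|c x y|c c' x].
  - exact: (splD eP (inner _ _ _ phiP)).
  - rewrite -extD; apply: eq_ext => a c'.
    by rewrite scalerDr (balDr phiP).
  - rewrite -scalC /lift [LHS](splT eP (inner _ _ _ phiP) (t := scal c')) //.
    by apply: eq_ext => a b; rewrite regE scalC (homM iP) (homZ iP) scalerA.
exists s'; split=> [G phi phiP x y|G phi phiP a x|G phi phiP t x [Tt|[c Sc ->]]|x].
- by rewrite !s'E (splD sP (liftP _ _ phiP)).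
- rewrite !s'E (splM sP (liftP _ _ phiP)); apply: eq_ext => c y.
  exact: (splM eP (inner _ _ _ phiP)).
- rewrite !s'E (splT sP (liftP _ _ phiP)) //; apply: eq_ext => c y.
  by apply: eq_ext => a c'; rewrite scalerA -TC // -scalerA.
- rewrite !s'E (splM sP (liftP _ _ phiP)); apply: eq_ext => c1 y.
  rewrite /lift [LHS](splT eP (inner _ _ _ phiP)) //.
  by apply: eq_ext => a c'; rewrite regE (homM iP) scalerA.
- rewrite s'E -[RHS](splK sP); apply: eq_ext => c y.
  rewrite -[in RHS](splK eP c) (ext_morph (f := fun c => iota c *: y)).
    by apply: eq_ext => a c'; rewrite regE (homM iP) scalerA.
  by move=> c1 c2; rewrite (homD iP) scalerDl.
Qed.

Record bilinear_map (A B : kalgType k) (G : zmodType) (psi : A -> B -> G) : Prop :=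
  BilinearMap {
  bilDl : forall a a' b, psi (a + a') b = psi a b + psi a' b;
  bilDr : forall a b b', psi a (b + b') = psi a b + psi a b';
  bilZ : forall a c b, psi (a * scal c) b = psi a (scal c * b) }.

(** [rep] exhibits [C] as the tensor product of [A] and [B] through [i] and
    [j]. *)
Record decomposition (A B C : kalgType k) (i : A -> C) (j : B -> C)
    (rep : C -> seq (A * B)) : Prop := Decomposition {
  decD : forall (G : zmodType) (psi : A -> B -> G), bilinear_map psi ->
    forall x y, ext psi (rep (x + y)) = ext psi (rep x) + ext psi (rep y);
  decE : forall (G : zmodType) (psi : A -> B -> G), bilinear_map psi ->
    forall a b, ext psi (rep (i a * j b)) = psi a b;
  decK : forall c, ext (fun a b => i a * j b) (rep c) = c }.

(** As a module over [A], the tensor product of [A] and [B] is induced from the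
    vector space [B]; the section sends a (x) b to a (x) (1 (x) b) and is
    linear over [B]. *)
Lemma decomposition_splitting (A B C : kalgType k) (i : A -> C) (j : B -> C)
    (rep : C -> seq (A * B)) :
  kalg_hom i -> kalg_hom j -> (forall a b, i a * j b = j b * i a) ->
  decomposition i j rep ->
  exists e : C^o -> seq (A * C^o), splitting i (fun t => exists b, t = j b) e.
Proof.
move=> iP jP ijC repP.
pose e (c : C^o) : seq (A * C^o) := [seq (u.1, j u.2) | u <- rep c].
have regE (c : C) (c' : C^o) : c *: c' = c * c' by [].
have eE (G : zmodType) (phi : A -> C^o -> G) c :
    ext phi (e c) = ext (fun a b => phi a (j b)) (rep c).
  by rewrite /ext big_map.
have bil (G : zmodType) (phi : A -> C^o -> G) :
    balanced phi -> bilinear_map (fun a b => phi a (j b)).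
  move=> phiP; split=> *; first exact: (balDl phiP).
  - by rewrite (homD jP) (balDr phiP).
  - by rewrite (balZ phiP) (homM jP) (homZ jP).
have eD (G : zmodType) (phi : A -> C^o -> G) x y : balanced phi ->
    ext phi (e (x + y)) = ext phi (e x) + ext phi (e y).
  by move=> /bil phiP; rewrite !eE (decD repP phiP).
have eij (G : zmodType) (phi : A -> C^o -> G) a b : balanced phi ->
    ext phi (e (i a * j b)) = phi a (j b).
  by move=> /bil phiP; rewrite !eE (decE repP phiP).
have C_ind (P : C -> Prop) : (forall a b, P (i a * j b)) ->
    (forall x y, P x -> P y -> P (x + y)) -> forall x, P x.
  move=> Pij PD x; rewrite -(decK repP x) /ext.
  have P0 : P 0 by have := Pij 0 0; rewrite (addm0 (homD iP)) mul0r.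
  by elim: (rep x) => [|u z IH]; rewrite ?big_nil // big_cons; apply: PD.
exists e; split=> [G phi phiP x y|G phi phiP a x|G phi phiP _ x [b ->]|x].
- exact: eD.
- have aP := balanced_mul a phiP.
  elim/C_ind: x => [a' b'|x y IHx IHy].
    by rewrite regE mulrA -(homM iP) !eij.
  by rewrite scalerDr !eD // IHx IHy.
- have bP := balanced_scale (j b) phiP.
  elim/C_ind: x => [a' b'|x y IHx IHy].
    by rewrite regE mulrA -ijC -mulrA -(homM jP) !eij // regE (homM jP).
  by rewrite scalerDr !eD // IHx IHy.
- by rewrite eE -[RHS](decK repP).
Qed.

Section TensorSplittings.
Variables A B : kalgType k.

Lemma tensor_decomposition :
  decomposition (fun a => pure a 1 : tensor A B) (fun b => pure 1 b) (@tensor_repr A B).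
Proof.
pose lift (G : zmodType) (psi : A -> B -> G) (t : tensor A B) : G := bt_lift psi t.
have liftD (G : zmodType) (psi : A -> B -> G) : bilinear_map psi ->
    {morph lift G psi : t t' / t + t'}.
  by move=> [Dl Dr Z] t t'; apply: bt_liftD.
have lift_pure (G : zmodType) (psi : A -> B -> G) : bilinear_map psi ->
    forall a b, lift G psi (pure a b) = psi a b.
  by move=> [Dl Dr Z] a b; apply: bt_liftE.
have extE (G : zmodType) (psi : A -> B -> G) t : bilinear_map psi ->
    ext psi (tensor_repr t) = lift G psi t.
  move=> psiP; rewrite -[in RHS](tensor_reprE t) (addm_sum (liftD _ _ psiP)).
  by apply: eq_bigr => u _; rewrite lift_pure.
split=> [G psi psiP x y|G psi psiP a b|t].
- by rewrite !extE // liftD.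
- by rewrite pureM mulr1 mul1r extE // lift_pure.
- by rewrite -[RHS]tensor_reprE; apply: eq_bigr => u _; rewrite pureM mulr1 mul1r.
Qed.

Lemma decomposition_swap (C : kalgType k) (i : A -> C) (j : B -> C) rep :
  (forall a b, i a * j b = j b * i a) -> decomposition i j rep ->
  decomposition j i (fun c => [seq (u.2, u.1) | u <- rep c]).
Proof.
move=> ijC repP.
have swapE (G : zmodType) (psi : B -> A -> G) z :
    ext psi [seq (u.2, u.1) | u <- z] = ext (fun a b => psi b a) z.
  by rewrite /ext big_map.
have bil (G : zmodType) (psi : B -> A -> G) :
    bilinear_map psi -> bilinear_map (fun a b => psi b a).
  by move=> [Dl Dr Z]; split=> [*|*|a c b] //; rewrite -scalC -Z scalC.
split=> [G psi psiP x y|G psi psiP b a|c]; rewrite !swapE.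
- exact: (decD repP (bil _ _ psiP)).
- by rewrite -ijC (decE repP (bil _ _ psiP)).
- by rewrite -[RHS](decK repP); apply: eq_ext => a b.
Qed.

(** The two factors are treated one after the other.  Elements of [A] join the
    set of preserved operators before the homotopy is made linear over [B]. *)
Theorem dim_le_tensor a b : dim_le A a -> dim_le B b -> dim_le (tensor A B) (a + b).
Proof.
move=> dimA dimB R iota T K d iotaP TC Tk dP sP r hP.
pose i (x : A) : tensor A B := pure x 1; pose j (y : B) : tensor A B := pure 1 y.
have iP : kalg_hom i := pure_homl A B; have jP : kalg_hom j := pure_homr A B.
have ijC x y : i x * j y = j y * i x by rewrite !pureM !mulr1 !mul1r.
have [ei eiP] := decomposition_splitting iP jP ijC tensor_decomposition.
have [ej ejP] := decomposition_splitting jP iP (fun y x => esym (ijC x y))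
  (decomposition_swap ijC tensor_decomposition).
have [h1 h1P] : exists h, contraction (adjoin T (iota \o i)) d (r + a) h.
  apply: dimA hP => //; first exact: kalg_hom_comp.
  - by move=> t x Tt; apply: TC.
  - by apply: complex_sub dP => t [Tt|[x ->]]; [left|right; exists (i x)].
  - move=> n; have [s snP] := sP n.
    have [|s' s'P] := splitting_trans iP iotaP TC Tk _ snP eiP.
      by move=> c; exists (scal c); rewrite (homZ jP).
    by exists s'; apply: splitting_sub s'P => t Tt; left.
have [h2 h2P] : exists h,
    contraction (adjoin (adjoin T (iota \o i)) (iota \o j)) d (r + a + b) h.
  apply: dimB (ex_intro _ _ h1P) => //; first exact: kalg_hom_comp.
  - move=> t y [Tt|[x ->]] /=; first exact: TC.
    by rewrite -!(homM iotaP) ijC.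
  - by move=> c; left.
  - apply: complex_sub dP => t [[Tt|[x ->]]|[y ->]]; first by left.
      by right; exists (i x).
    by right; exists (j y).
  - move=> n; have [s snP] := sP n.
    have [|s' s'P] := splitting_trans jP iotaP TC Tk _ snP ejP.
      by move=> c; exists (scal c); rewrite (homZ iP).
    exists s'; apply: splitting_sub s'P => t [Tt|[x ->]]; [by left|right].
    by exists (i x) => //; exists x.
exists h2; rewrite addnA; split; [exact: (ctrD h2P)| |exact: (ctrE h2P)].
move=> n t x [Tt|[{}t ->]]; first by apply: (ctrZ h2P); left; left.
elim/(@tensor_ind k A B): t => [u v|t t' IHt IHt'].
  have -> : pure u v = i u * j v by rewrite pureM mulr1 mul1r.
  rewrite (homM iotaP) -!scalerA (ctrZ h2P) ?(ctrZ h2P) //.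
    by right; exists v.
  by left; right; exists u.
by rewrite (homD iotaP) !scalerDl (ctrD h2P) IHt IHt'.
Qed.

End TensorSplittings.

End ContractionDimension.

(** * Leavitt path algebras have dimension at most one *)

Section LeavittDimension.
Variables (k : fieldType) (E : quiver).
Local Notation L := (leavitt k E).
Local Notation vtx := (@lpa_vtx k E).
Local Notation arr := (@lpa_arr k E).

Section Step.
Variables (R : kalgType k) (iota : L -> R) (T : R -> Prop).
Variables (K : nat -> lmodType R) (d : forall i, K i.+1 -> K i).
Hypothesis iotaP : kalg_hom iota.
Hypothesis TC : forall t a, T t -> t * iota a = iota a * t.
Hypothesis Tk : forall c, T (scal c).
Hypothesis dP : complex (adjoin T iota) d.
Variable r : nat.

Let dD i : {morph d (i := i) : x y / x + y} .
Proof. exact: (cpxD dP). Qed.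
Let dL i a x : d (i := i) (iota a *: x) = iota a *: d x.
Proof. by apply: (cpxZ dP); right; exists a. Qed.
Let dT i t x : T t -> d (i := i) (t *: x) = t *: d x.
Proof. by move=> Tt; apply: (cpxZ dP); left. Qed.

(** The vertices are orthogonal idempotents of sum 1, hence the homotopy can be
    cut into its diagonal blocks. *)
Lemma contraction_average h : contraction T d r h ->
  exists2 h', contraction T d r h' &
    forall n i x, h' n (iota (vtx i) *: x) = iota (vtx i) *: h' n x.
Proof.
move=> [hD hT hE].
pose p i := iota (vtx i).
have pp i j n (x : K n) : p i *: (p j *: x) = if i == j then p i *: x else 0.
  rewrite /p scalerA -(homM iotaP) vtxM; case: ifP => // _.
  by rewrite (addm0 (homD iotaP)) scale0r.
have p1 n (x : K n) : \sum_i p i *: x = x.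
  by rewrite -scaler_suml -(addm_sum (homD iotaP)) sum_vtx (hom1 iotaP) scale1r.
have pT i t n (x : K n) : T t -> p i *: (t *: x) = t *: (p i *: x).
  by move=> Tt; rewrite !scalerA TC.
exists (fun n x => \sum_i p i *: h n (p i *: x)).
  split=> [n x y|n t x Tt|n rn x].
  - by rewrite -big_split; apply: eq_bigr => i _; rewrite scalerDr hD scalerDr.
  - rewrite scaler_sumr; apply: eq_bigr => i _.
    by rewrite pT // hT // pT.
  - rewrite (addm_sum (@dD _)) -big_split -[RHS]p1; apply: eq_bigr => i _ /=.
    by rewrite dL -scalerDr -dL hE // pp eqxx.
move=> n i x; rewrite scaler_sumr; apply: eq_bigr => j _.
rewrite !pp [j == i]eq_sym; case: eqP => [->|_] //.
by rewrite (addm0 (@hD n)) scaler0.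
Qed.

Section Correction.
Variable h : forall i, K i -> K i.+1.
Hypothesis hP : contraction T d r h.
Hypothesis hv : forall n i x, h (i := n) (iota (vtx i) *: x) = iota (vtx i) *: h x.

Let hD n : {morph h (i := n) : x y / x + y}.
Proof. exact: (ctrD hP). Qed.
Let hT n t x : T t -> h (i := n) (t *: x) = t *: h x.
Proof. exact: (ctrZ hP). Qed.
Let hE n : (r <= n)%N -> forall x : K n.+1, h (d x) + d (h x) = x.
Proof. exact: (ctrE hP). Qed.

(* The commutator [l, h], in every degree. *)
Let delta n (l : L) (x : K n) : K n.+1 := iota l *: h x - h (iota l *: x).

(** The value [a, h] h on an arrow [a] is chosen for [correction_homotopy]:
    since [a, h] anticommutes with d and d h + h d = 1, the commutator of d
    with [a, h] h is - [a, h]. *)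
Lemma correction_exists n : exists D : L -> K n -> K n.+2,
  [/\ derivation iota D,
      forall a x, D (arr (inl a)) x = delta (arr (inl a)) (h x) &
      forall t l x, T t -> D l (t *: x) = t *: D l x].
Proof.
pose u a (x : K n) : K n.+2 := delta (arr (inl a)) (h x).
have uD a : {morph u a : x y / x + y}.
  by move=> x y; rewrite /u /delta !(hD, scalerDr) opprD addrACA.
have uT a t x : T t -> u a (t *: x) = t *: u a x.
  move=> Tt; rewrite /u /delta !(hT _ Tt) !scalerA -TC // -!scalerA (hT _ Tt).
  by rewrite scalerBr.
have [a c x|a x|a x|D DP Da] := @derivation_exists k E R iota iotaP _ _ u uD.
- exact: uT.
- rewrite /u /delta scalerBr -hv !scalerA -(homM iotaP).
  by rewrite (vtx_arr k (inl a)).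
- rewrite /u /delta !hv !scalerA -(homM iotaP).
  by rewrite (arr_vtx k (inl a)).
exists D; split=> // t l x Tt; apply/eqP; rewrite -subr_eq0; apply/eqP.
pose D' l x := D l (t *: x) - t *: D l x.
have [DDl DDr DM DZ Dv] := DP.
suff: forall l x, D' l x = 0 by apply.
apply: (derivation_eq0 iotaP) => [|a y]; last by rewrite /D' !Da -/(u a _) uT ?subrr.
have tL (V : lmodType R) m (y : V) : t *: (iota m *: y) = iota m *: (t *: y).
  by rewrite !scalerA TC.
apply: derivationB.
  exact: (derivation_comp (f := *:%R t) (g := id) (scalerDr t) (tL _)).
exact: (derivation_comp (f := id) (g := *:%R t) _ _ (scalerDr t) (tL _)).
Qed.

Section Corrected.
Variable D : forall n, L -> K n -> K n.+2.
Hypothesis DP : forall n, derivation iota (@D n).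
Hypothesis Da : forall n a x, D (n := n) (arr (inl a)) x = delta (arr (inl a)) (h x).
Hypothesis DT : forall n t l x, T t -> D (n := n) l (t *: x) = t *: D l x.

(** Both sides are derivations in [l], so it suffices to compare them on the
    arrows of the quiver. *)
Lemma correction_homotopy n : (r <= n)%N -> forall l (x : K n.+1),
  d (D l x) = D l (d x) - delta l x.
Proof.
move=> rn l x; pose D' l (x : K n.+1) := (D l (d x) - d (D l x)) - delta l x.
have hB := addmB (@hD _); have dB := addmB (@dD _).
suff /eqP : D' l x = 0 by rewrite /D' addrAC subr_eq0 => /eqP ->.
move: l x; apply: (derivation_eq0 iotaP) => [|a x].
  apply: derivationB; last first.
    by apply: inner_derivation => // c y; exact: hT.
  apply: derivationB.
    exact: (derivation_comp (f := @d _) (g := id) (@dD _) (@dL _)).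
  exact: (derivation_comp (f := id) (g := @d _) _ _ (@dD _) (@dL _)).
have dh m : (r <= m)%N -> forall y : K m.+1, d (h y) = y - h (d y).
  by move=> rm y; apply/eqP; rewrite eq_sym subr_eq addrC hE.
have dhh : d (h (h x)) = h (h (d x)).
  by rewrite dh ?(leqW rn) // dh // hB opprB addrC subrK.
have dha : d (h (iota (arr (inl a)) *: h x))
    = delta (arr (inl a)) x + h (iota (arr (inl a)) *: h (d x)).
  by rewrite dh ?(leqW rn) // dL dh // scalerBr hB opprB addrA addrAC.
rewrite /D' !Da {1 2}/delta dB dL dhh dha opprB.
by rewrite [X in X - _]addrC addrA subrK addrK subrr.
Qed.

Variable s : forall n, K n -> seq (L * K n).
Hypothesis sP : forall n, splitting iota T (@s n).

(** With the section s of the action, viewed in the tensor product of L(E) and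
    K, the first term is the linearization of h through s, and the other two
    apply the derivation D to the failure s d - (1 (x) d) s of s to be a chain
    map. *)
Definition leavitt_homotopy n : K n -> K n.+1 :=
  match n with
  | 0 => fun=> 0
  | n.+1 => fun x => ext (fun l y => iota l *: h y) (s x)
      + (ext (fun l y => D l y) (s (d x)) - ext (fun l y => D l (d y)) (s x))
  end.

(** Let e = s d - (1 (x) d) s.  The action map kills e, whence D, applied to
    the first tensor factor of e, is linear over L(E).  In d h' + h' d the first
    term contributes 1 plus the value of l (x) y |-> l h y on e, and by
    [correction_homotopy] the correction contributes minus the value of
    l (x) y |-> [l, h] y on e.  These values agree, since the action map kills
    e. *)
Lemma leavitt_homotopyP : contraction (adjoin T iota) d r.+1 leavitt_homotopy.
Proof.
have iZ c := homZ iotaP c.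
have bal1 n : balanced (fun l (y : K n) => iota l *: h y).
  split=> [a b x|a x y|a c x].
  - by rewrite (homD iotaP) scalerDl.
  - by rewrite hD scalerDr.
  - by rewrite (homM iotaP) iZ hT // scalerA.
have bal2 n : balanced (fun l (y : K n) => D l y).
  split=> [a b x|a x y|a c x].
  - exact: (derDl (DP n)).
  - exact: (derDr (DP n)).
  - by rewrite (derM (DP n)) (derZ (DP n)) scaler0 add0r iZ.
have bal3 n : balanced (fun l (y : K n.+1) => D l (d y)).
  split=> [a b x|a x y|a c x].
  - exact: (derDl (DP n)).
  - by rewrite dD (derDr (DP n)).
  - by rewrite dT // (balZ (bal2 n)).
have hom_scale (V : lmodType R) t : {morph (fun x : V => t *: x) : x y / x + y}.
  exact: scalerDr.
split.
- move=> [|n] x y /=; first by rewrite addr0.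
  rewrite dD (splD (sP _) (bal1 _)) (splD (sP _) (bal2 _)) (splD (sP _) (bal3 _)).
  by rewrite [RHS]addrACA opprD; congr (_ + _); rewrite addrACA.
- move=> [|n] t x; first by rewrite scaler0.
  case=> [Tt|[m ->]] /=.
    rewrite dT // !scalerDr scalerN !(ext_morph _ _ (hom_scale _ t)).
    congr (_ + (_ - _)).
    + rewrite (splT (sP _) (bal1 _)) //; apply: eq_ext => l y.
      by rewrite hT // !scalerA TC.
    + rewrite (splT (sP _) (bal2 _)) //; apply: eq_ext => l y.
      by rewrite DT.
    + rewrite (splT (sP _) (bal3 _)) //; apply: eq_ext => l y.
      by rewrite dT // DT.
  rewrite dL (splM (sP _) (bal1 _)) (splM (sP _) (bal2 _)) (splM (sP _) (bal3 _)).
  rewrite !scalerDr scalerN !(ext_morph _ _ (hom_scale _ (iota m))).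
  congr (_ + _); first by apply: eq_ext => l y; rewrite (homM iotaP) scalerA.
  have Dm (z : seq (L * K n)) : ext (fun l y => D (m * l) y) z =
      ext (fun l y => iota m *: D l y) z + D m (ext (fun l y => iota l *: y) z).
    rewrite (ext_morph _ _ (derDr (DP n) m)) -extD.
    by apply: eq_ext => l y; rewrite (derM (DP n)).
  have Dm' (z : seq (L * K n.+1)) : ext (fun l y => D (m * l) (d y)) z =
      ext (fun l y => iota m *: D l (d y)) z + D m (d (ext (fun l y => iota l *: y) z)).
    rewrite (ext_morph _ _ (@dD n)) (ext_morph _ _ (derDr (DP n) m)) -extD.
    by apply: eq_ext => l y; rewrite (derM (DP n)) dL.
  rewrite Dm Dm' !(splK (sP _)).
  by rewrite opprD addrACA subrr addr0.
case=> // n rn x /=.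
have s0 : ext (fun l y => D l y) (s (d (d x))) = 0.
  by rewrite (cpx2 dP); apply: addm0 (splD (sP n) (bal2 n)).
have dh m : (r <= m)%N -> forall y : K m.+1, d (h y) = y - h (d y).
  by move=> rm y; apply/eqP; rewrite eq_sym subr_eq addrC hE.
have hB := addmB (@hD _); have dB := addmB (@dD _).
set X1 := ext _ (s (d x)); set X2 := ext _ (s (d x)).
pose Y := ext (fun l y => iota l *: h (d y)) (s x).
have d1 : d (ext (fun l y => iota l *: h y) (s x)) = x - Y.
  rewrite (ext_morph _ _ (@dD _)) -[in RHS](splK (sP _) x) -extB.
  by apply: eq_ext => l y; rewrite dL dh ?leqW // scalerBr.
have d2 : d (ext (fun l y => D l y) (s (d x))) = X2 - (X1 - h (d x)).
  rewrite (ext_morph _ _ (@dD _)) -[in RHS](splK (sP _) (d x)).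
  rewrite (ext_morph _ _ (@hD _)) -!extB.
  by apply: eq_ext => l y; rewrite correction_homotopy.
have d3 : d (ext (fun l y => D l (d y)) (s x)) = - (Y - h (d x)).
  rewrite (ext_morph _ _ (@dD _)) -[in RHS](splK (sP _) x).
  rewrite (ext_morph _ _ (@dD _)) (ext_morph _ _ (@hD _)) -extB /ext -sumrN.
  apply: eq_bigr => u _; rewrite correction_homotopy //.
  by rewrite (cpx2 dP) (addm0 (derDr (DP n) _)) sub0r dL.
rewrite s0 dD dB d1 d2 d3 sub0r opprK; set H := h (d x).
have -> : X2 - (X1 - H) + (Y - H) = X2 - X1 + Y.
  by rewrite opprB addrA [X2 + _]addrCA addrAC [H + _]addrC addrK.
by rewrite [x - Y + _]addrCA subrK addrA addrA subrK subrr add0r.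
Qed.

End Corrected.

End Correction.

End Step.

Theorem dim_le_leavitt : dim_le L 1.
Proof.
move=> R iota T K d iotaP TC Tk dP sP r [h0 h0P].
have [h hP hv] := contraction_average iotaP TC dP h0P.
have De := correction_exists iotaP TC Tk hP hv.
pose D n := sval (cid (De n)); have DP n : _ := svalP (cid (De n)).
pose s n := sval (cid (sP n)).
exists (leavitt_homotopy iota d h D s); rewrite addn1.
by apply: leavitt_homotopyP => // n; [case: (DP n)..|exact: svalP (cid (sP n))].
Qed.

End LeavittDimension.

(** * Retractions of injective linear maps *)

Section LinearRetraction.
Variables (k : fieldType) (A : kalgType k) (f : A -> A).
Hypothesis fD : {morph f : x y / x + y}.
Hypothesis fZ : forall c x, f (scal c * x) = scal c * f x.
Hypothesis f_inj : forall x, f x = 0 -> x = 0.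

(* Graphs of linear maps on subspaces containing the image of f, inverse to f
   there. *)
Let good (G : set (A * A)) : Prop :=
  [/\ forall a, G (f a, a), forall u v, G u -> G v -> G (u.1 + v.1, u.2 + v.2),
      forall c u, G u -> G (scal c * u.1, scal c * u.2) &
      forall b, G (0, b) -> b = 0].

Let maximal_good : exists2 G, good G & forall w, exists b, G (w, b).
Proof.
have good0 : good [set u | u.1 = f u.2].
  by split=> [a|u v /= -> ->|c u /= ->|b /= /esym] //; rewrite ?fD ?fZ //; exact: f_inj.
(* The empty set is admitted because it is the union of the empty chain. *)
have [G [GP Gmax]] : exists G, (G = set0 \/ good G) /\
    forall H, (G `<` H)%classic -> ~ (H = set0 \/ good H).
  apply: (@Zorn_bigcup _ (fun G => G = set0 \/ good G)) => F FP Ftot.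
  have [[G FG GN]|allN] := pselect (exists2 G, F G & G <> set0); last first.
    left; rewrite -subset0 => u [G FG Gu]; case: allN; exists G => //.
    by move=> G0; rewrite G0 in Gu.
  have gF H : F H -> forall u, H u -> good H.
    by move=> /FP[->|//].
  have gG : good G by case: (FP _ FG).
  right; split.
  - by move=> a; exists G => //; case: gG.
  - move=> u v [H FH Hu] [H' FH' Hv].
    have [HH'|H'H] := Ftot _ _ FH FH'.
      by exists H' => //; case: (gF _ FH' _ Hv) => _ + _ _; apply=> //; exact: HH'.
    by exists H => //; case: (gF _ FH _ Hu) => _ + _ _; apply=> //; exact: H'H.
  - move=> c u [H FH Hu]; exists H => //.
    by case: (gF _ FH _ Hu) => _ _ + _; apply.
  - by move=> z [H FH Hz]; case: (gF _ FH _ Hz) => _ _ _ H0; exact: H0.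
have {}GP : good G.
  case: GP => // G0; case: (Gmax [set u : A * A | u.1 = f u.2]%classic); last by right.
  by rewrite G0; split=> // /(_ (f 0, 0) erefl).
exists G => // w; apply: contrapT => wN; have [Gf GD GZ G0] := GP.
(* The extension by zero of G to the line spanned by w. *)
pose H : set (A * A) :=
  [set u | exists c, exists2 v, G v & u = (v.1 + scal c * w, v.2)]%classic.
case: (Gmax H).
  split=> [u Gu|].
    by exists 0, u => //; rewrite scal0 mul0r addr0 -surjective_pairing.
  move=> HG; apply: wN; exists 0; apply: HG.
  exists 1, (0, 0); last by rewrite scal1 mul1r add0r.
  by have := Gf 0; rewrite (addm0 fD).
right; split.
- by move=> a; exists 0, (f a, a) => //; rewrite scal0 mul0r addr0.
- move=> _ _ [c [u Gu ->]] [d [v Gv ->]]; exists (c + d), (u.1 + v.1, u.2 + v.2) => /=.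
    exact: GD.
  by rewrite scalD mulrDl addrACA.
- move=> c _ [d [u Gu ->]]; exists (c * d), (scal c * u.1, scal c * u.2) => /=.
    exact: GZ.
  by rewrite mulrDr scalM mulrA.
- move=> _ [c [[v b'] Gv [/= uw ->]]]; have [c0|c0] := eqVneq c 0.
    by apply: G0; move: uw Gv; rewrite c0 scal0 mul0r addr0 => <-.
  case: wN; exists (scal (- c^-1) * b'); have /= := GZ (- c^-1) _ Gv.
  suff -> : scal (- c^-1) * v = w by [].
  move/eqP: uw; rewrite eq_sym addr_eq0 => /eqP ->.
  by rewrite mulrN scalN mulNr opprK mulrA -scalM mulVf // scal1 mul1r.
Qed.

(** Over a field every injective linear map splits; Zorn's lemma extends the
    inverse of [f] from the image of [f] to the whole space. *)
Lemma linear_retraction : exists rho : A -> A,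
  [/\ {morph rho : x y / x + y}, forall c x, rho (scal c * x) = scal c * rho x &
      forall x, rho (f x) = x].
Proof.
have [G [Gf GD GZ G0] Gtot] := maximal_good.
have [rho Grho] := choice Gtot.
have Gfun w b b' : G (w, b) -> G (w, b') -> b = b'.
  move=> Gb /(GZ (- 1)) /= Gb'; apply/eqP; rewrite -subr_eq0; apply/eqP/G0.
  by have := GD _ _ Gb Gb'; rewrite /= scalN scal1 !mulN1r subrr.
exists rho; split=> [x y|c x|x]; apply: (Gfun _ _ _ (Grho _)).
- exact: GD (Grho x) (Grho y).
- exact: GZ (Grho x).
- exact: Gf.
Qed.

End LinearRetraction.

(** * A functional that is invariant under a closed path *)

Section Interleaving.
Variables (k : fieldType) (N : nat).
Hypothesis N_gt0 : (0 < N)%N.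

(** The bijection between {0, ..., N-1} x nat and nat given by
    (i, n) |-> n N + i turns a polynomial into an N-tuple of polynomials:
    [gather i] extracts its i-th component, and [spread i] embeds it. *)
Definition spread (i : nat) (p : {poly k}) : {poly k} := 'X^i * (p \Po 'X^N).
Definition gather (i : nat) (p : {poly k}) : {poly k} :=
  \poly_(n < size p) p`_(n * N + i).

Lemma coef_spread i p n :
  (spread i p)`_n = if (i <= n)%N && (N %| n - i)%N then p`_((n - i) %/ N) else 0.
Proof.
rewrite /spread coefXnM coef_comp_poly_Xn //.
by rewrite ltnNge; case: (i <= n)%N.
Qed.

Lemma coef_gather i p n : (gather i p)`_n = p`_(n * N + i).
Proof.
rewrite coef_poly; case: ltnP => // pn; rewrite nth_default //.
by apply: (leq_trans pn); rewrite (leq_trans (leq_pmulr n N_gt0)) ?leq_addr.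
Qed.

Lemma spreadD i : {morph spread i : p q / p + q}.
Proof. by move=> p q; rewrite /spread comp_polyD mulrDr. Qed.

Lemma spreadZ i c p : spread i (c *: p) = c *: spread i p.
Proof. by rewrite /spread comp_polyZ scalerAr. Qed.

Lemma gatherD i : {morph gather i : p q / p + q}.
Proof. by move=> p q; apply/polyP => n; rewrite !(coef_gather, coefD). Qed.

Lemma gatherZ i c p : gather i (c *: p) = c *: gather i p.
Proof. by apply/polyP => n; rewrite !(coef_gather, coefZ). Qed.

Lemma horner1_spread i p : (spread i p).[1] = p.[1].
Proof. by rewrite /spread hornerM horner_comp !hornerXn !expr1n mul1r. Qed.

Lemma gather_spread i j p : (i < N)%N -> (j < N)%N ->
  gather j (spread i p) = if i == j then p else 0.
Proof.
move=> iN jN; apply/polyP => n; rewrite coef_gather coef_spread.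
have [->|ij] := eqVneq i j.
  by rewrite leq_addl addnK dvdn_mull // mulnK.
rewrite coef0; case: andP => // -[ile].
rewrite -eqn_mod_dvd // => /eqP; rewrite modnMDl !modn_small // => ji.
by rewrite ji eqxx in ij.
Qed.

Lemma sum_spread_gather p : \sum_(i < N) spread i (gather i p) = p.
Proof.
apply/polyP => n; rewrite coef_sum.
rewrite (bigD1 (Ordinal (ltn_pmod n N_gt0))) //= big1 ?addr0 => [|i ni].
  have nE : (n - n %% N = n %/ N * N)%N by rewrite {1}(divn_eq n N) addnK.
  by rewrite coef_spread leq_mod nE dvdn_mull // mulnK //= coef_gather -divn_eq.
rewrite coef_spread; case: andP => // -[ile]; rewrite -eqn_mod_dvd // => /eqP ji.
case/eqP: ni; apply: val_inj; rewrite /= ji modn_small //.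
Qed.

End Interleaving.

Section PathEvaluation.
Variables (k : fieldType) (E : quiver).
Local Notation L := (leavitt k E).
Local Notation vtx := (@lpa_vtx k E).
Local Notation arr := (@lpa_arr k E).

Definition path_elt (p : seq (arrow E)) : L :=
  foldr (fun a z => arr (inl a) * z) 1 p.

Let out (i : vertex E) : pred (arrow E) := [pred a | src a == i].
Let deg (i : vertex E) := #|out i|.
Let idx (a : arrow E) : nat := index a (enum (out (src a))).

Let deg_gt0 a : (0 < deg (src a))%N.
Proof. by apply/card_gt0P; exists a; rewrite inE. Qed.

Let idx_lt a : (idx a < deg (src a))%N.
Proof. by rewrite /deg cardE index_mem mem_enum inE. Qed.

Let idx_inj a b : src a = src b -> (idx a == idx b) = (a == b).
Proof.
move=> ab; apply/eqP/eqP => [|->//]; rewrite /idx ab => iab.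
have mem c : src c = src b -> c \in enum (out (src b)).
  by move=> cb; rewrite mem_enum inE cb.
by rewrite -(nth_index b (mem a ab)) iab nth_index // mem.
Qed.

Let sum_out (V : nmodType) i (F : nat -> V) :
  \sum_(a | src a == i) F (idx a) = \sum_(j < deg i) F j.
Proof.
rewrite (big_enum_val (A := out i) (fun a => F (idx a))).
apply: eq_bigr => j _; congr F; rewrite /idx.
have /eqP -> : src (enum_val j) == i by exact: (enum_valP j).
rewrite {1}/enum_val index_uniq ?enum_uniq // -cardE; exact: ltn_ord.
Qed.

Let V : zmodType := {ffun vertex E -> {poly k}}.
Let sc (c : k) (f : V) : V := [ffun v => c *: f v].
Let pv i (f : V) : V := [ffun v => if v == i then f v else 0].
Let pa (a : arrow (double_quiver E)) (f : V) : V :=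
  match a with
  | inl a => [ffun v => if v == src a then spread (deg (src a)) (idx a) (f (rng a)) else 0]
  | inr a => [ffun v => if v == rng a then gather (deg (src a)) (idx a) (f (src a)) else 0]
  end.

(** L(E) acts on a sum of copies of k[X] indexed by the vertices: the N arrows
    starting at a vertex act by the maps [spread i] for i < N, their ghost
    arrows by the maps [gather i].  Since [spread i] preserves the value at 1,
    evaluation at 1 over the base vertex is invariant under the closed path;
    [lam] evaluates the images of the constant vector 1. *)
Lemma evaluation_functional a p :
  path (fun b c : arrow E => rng b == src c) a p -> src a = rng (last a p) ->
  exists lam : L -> k,
  [/\ {morph lam : x y / x + y}, forall c x, lam (scal c * x) = c * lam x,
      lam 1 = 1 & forall x, lam ((1 - path_elt (a :: p)) * x) = 0].
Proof.
move=> pP ap.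
have [|||||||||||||act [aDl aDr aM aZ [av aa]]] :=
  @leavitt_representation k E V sc pv pa.
- by move=> c f g; apply/ffunP => v; rewrite !ffunE scalerDr.
- by move=> f; apply/ffunP => v; rewrite !ffunE scale1r.
- by move=> c d f; apply/ffunP => v; rewrite !ffunE scalerDl.
- by move=> c d f; apply/ffunP => v; rewrite !ffunE scalerA.
- by move=> i f g; apply/ffunP => v; rewrite !ffunE; case: ifP; rewrite ?addr0.
- move=> [b|b] f g; apply/ffunP => v; rewrite !ffunE; case: ifP; rewrite ?addr0 // => _.
    by rewrite spreadD.
  by rewrite gatherD.
- by move=> i c f; apply/ffunP => v; rewrite !ffunE; case: ifP; rewrite ?scaler0.
- move=> [b|b] c f; apply/ffunP => v; rewrite !ffunE; case: ifP; rewrite ?scaler0 // => _.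
    by rewrite spreadZ.
  by rewrite gatherZ.
- move=> i j f; case: (eqVneq i j) => [->|/negPf ij]; apply/ffunP => v; rewrite !ffunE.
    by case: (v == j).
  by case: eqP => // ->; rewrite ij.
- by move=> [b|b] f; apply/ffunP => v; rewrite !ffunE; case: ifP => // ->.
- by move=> [b|b] f; apply/ffunP => v; rewrite !ffunE eqxx.
- move=> b c f; apply/ffunP => v; rewrite !ffunE.
  have [bc|/eqP bc] := eqVneq (src b) (src c).
    rewrite bc gather_spread ?idx_lt //; last by rewrite -bc idx_lt.
    rewrite eq_sym idx_inj // eq_sym.
    by have [->|_] := eqVneq b c; rewrite ffunE //; case: ifP => // /eqP ->.
  rewrite (addm0 (@gatherD _ _ (deg_gt0 b) _)).
  rewrite if_same; case: eqVneq => [bc'|_]; last by rewrite ffunE.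
  by case: bc; rewrite bc'.
- move=> i f iN; apply/ffunP => v; rewrite sum_ffunE ffunE.
  case: eqP => [->|vi]; last first.
    by rewrite big1 // => b /eqP bi; rewrite ffunE bi; case: eqP.
  rewrite -[LHS](@sum_spread_gather _ (deg i)); last first.
    by case/forallPn: iN => b; rewrite negbK => /eqP <-.
  rewrite -(sum_out i (fun j => spread (deg i) j (gather (deg i) j (f i)))); apply: eq_bigr => b /eqP bi.
  by rewrite !ffunE bi !eqxx.
have act1 f : act 1 f = f.
  rewrite -sum_vtx (big_morph (act^~ f) (id1 := 0) (op1 := +%R)) //; last first.
    exact: (addm0 (f := act^~ f) (fun x y => aDl x y f)).
  apply/ffunP => v; rewrite sum_ffunE (bigD1 v) //= big1 ?addr0 => [|i /negPf iv].
    by rewrite av ffunE eqxx.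
  by rewrite av ffunE eq_sym iv.
pose ev v (f : V) := (f v).[1].
have evD v : {morph ev v : f g / f + g} by move=> f g; rewrite /ev ffunE hornerD.
have ev_arr b v f : v = src b -> ev v (act (arr (inl b)) f) = ev (rng b) f.
  by move=> ->; rewrite /ev aa ffunE eqxx horner1_spread.
have ev_path f : ev (src a) (act (path_elt (a :: p)) f) = ev (src a) f.
  rewrite [in RHS]ap /=; elim: p a pP {ap} => [|b p IH] a /=.
    by move=> _; rewrite mulr1 ev_arr.
  by case/andP=> /eqP ab bp; rewrite aM ev_arr // ab IH.
pose one : V := [ffun=> 1].
exists (fun x => ev (src a) (act x one)); split=> [x y|c x||x].
- by rewrite aDl evD.
- by rewrite aZ /ev ffunE hornerZ.
- by rewrite act1 /ev ffunE hornerC.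
- rewrite aM aDl evD act1.
  rewrite (addmN (f := act^~ _) (fun x y => aDl x y _)) (addmN (evD _)).
  by rewrite ev_path subrr.
Qed.

End PathEvaluation.

(** * The grading by path length *)

Section Grading.
Variables (k : fieldType) (E : quiver).
Local Notation L := (leavitt k E).
Local Notation vtx := (@lpa_vtx k E).
Local Notation arr := (@lpa_arr k E).

Definition shift (n : int) (a : L) (f : int -> L) : int -> L := fun d => a * f (d - n).

(** The grading with arrows in degree 1 and ghost arrows in degree -1, as an
    action on all functions from int to L(E): the degree d component of b is
    the value at d of b acting on the function supported at 0 with value 1. *)
Lemma grading : exists act : L -> (int -> L) -> int -> L,
  [/\ forall a b f, act (a + b) f = act a f + act b f,
      forall a, {morph act a : f g / f + g},
      forall a b f, act (a * b) f = act a (act b f),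
      forall c a f, act (scal c * a) f = shift 0 (scal c) (act a f) &
      [/\ forall i, act (vtx i) = shift 0 (vtx i),
          forall a, act (arr (inl a)) = shift 1 (arr (inl a)) &
          forall a, act (arr (inr a)) = shift (- 1) (arr (inr a))]].
Proof.
have shiftD n a : {morph shift n a : f g / f + g}.
  by move=> f g; apply/funext => d; rewrite /shift fctE mulrDr.
have shiftM n m a b f : shift n a (shift m b f) = shift (n + m) (a * b) f.
  by apply/funext => d; rewrite /shift mulrA opprD addrA.
have shift_sum n (I : finType) (P : pred I) (a : I -> L) f :
    shift n (\sum_(i | P i) a i) f = \sum_(i | P i) shift n (a i) f.
  by apply/funext => d; rewrite fct_sumE /shift mulr_suml.
have shift0 n f : shift n 0 f = 0 by apply/funext => d; rewrite /shift mul0r.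
pose wt (a : arrow (double_quiver E)) : int := if a is inl _ then 1 else - 1.
have [|||||||||||||act [aDl aDr aM aZ [av aa]]] :=
  @leavitt_representation k E (int -> L) (fun c => shift 0 (scal c))
    (fun i => shift 0 (vtx i)) (fun a => shift (wt a) (arr a)).
- by [].
- by move=> f; apply/funext => d; rewrite /shift scal1 mul1r subr0.
- by move=> c d f; apply/funext => e; rewrite /shift scalD mulrDl.
- by move=> c d f; rewrite shiftM scalM.
- by [].
- by [].
- by move=> i c f; rewrite !shiftM scalC.
- by move=> a c f; rewrite !shiftM scalC addrC.
- by move=> i j f; rewrite shiftM vtxM; case: ifP.
- by move=> a f; rewrite shiftM add0r vtx_arr.
- by move=> a f; rewrite shiftM addr0 arr_vtx.
- by move=> a b f; rewrite shiftM addNr ghost_arr; case: ifP.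
- move=> i f iN; rewrite (arr_ghost_sum k iN) shift_sum; apply: eq_bigr => a _.
  by rewrite shiftM subrr.
exists act; split=> //; split=> [i|a|a]; apply/funext => f; first exact: av.
  exact: aa.
exact: aa.
Qed.

(** If a = a c with c homogeneous of degree l > 0, then the components of a
    satisfy a_d = a_(d - l) c for all d, so they all vanish, because there are
    finitely many. *)
Lemma path_elt_not_right_zero_divisor p : p != [::] ->
  forall a : L, a = a * path_elt k p -> a = 0.
Proof.
move=> p0 a ap; set c := path_elt k p in ap.
have [act [aDl aDr aM aZ [av aa ag]]] := grading.
pose l : int := size p.
(* A finitely supported function is given by a list of homogeneous terms;
   the action of L(E) preserves such functions and is compatible with taking
   the sum of all terms. *)
pose delta (n : int) (x : L) : int -> L := fun d => if d == n then x else 0.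
pose coeffs (s : seq (int * L)) : int -> L := fun d => \sum_(u <- s | u.1 == d) u.2.
pose total (s : seq (int * L)) : L := \sum_(u <- s) u.2.
have act0 f : act 0 f = 0 by apply: addm0 (fun x y => aDl x y f).
have coeffs_shift n b s :
    shift n b (coeffs s) = coeffs [seq (u.1 + n, b * u.2) | u <- s].
  apply/funext => d; rewrite /shift /coeffs mulr_sumr big_map.
  by apply: eq_bigl => u; rewrite /= eq_sym subr_eq eq_sym.
have total_shift n b s : total [seq (u.1 + n, b * u.2) | u <- s] = b * total s.
  by rewrite /total mulr_sumr big_map.
have act_coeffs b : forall s, exists2 s', act b (coeffs s) = coeffs s' & total s' = b * total s.
  elim/leavitt_ind: b => [s|i s|[b|b] s|x y IHx IHy s|e x IHx s|x y IHx IHy s].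
  - by exists [::]; rewrite ?act0 /total ?big_nil ?mul0r //; apply/funext => d; rewrite /coeffs big_nil.
  - exists [seq (u.1 + 0, vtx i * u.2) | u <- s]; last exact: total_shift.
    by rewrite av coeffs_shift.
  - exists [seq (u.1 + 1, arr (inl b) * u.2) | u <- s]; last exact: total_shift.
    by rewrite aa coeffs_shift.
  - exists [seq (u.1 + (- 1), arr (inr b) * u.2) | u <- s]; last exact: total_shift.
    by rewrite ag coeffs_shift.
  - have [s1 e1 t1] := IHx s; have [s2 e2 t2] := IHy s; exists (s1 ++ s2).
      by rewrite aDl e1 e2; apply/funext => d; rewrite /coeffs big_cat.
    by rewrite /total big_cat mulrDl -t1 -t2.
  - have [s1 e1 t1] := IHx s.
    exists [seq (u.1 + 0, scal e * u.2) | u <- s1]; first by rewrite aZ e1 coeffs_shift.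
    by rewrite total_shift t1 mulrA.
  - have [s1 e1 t1] := IHy s; have [s2 e2 t2] := IHx s1; exists s2.
      by rewrite aM e1 e2.
    by rewrite t2 t1 mulrA.
have total0 s : (forall d, coeffs s d = 0) -> total s = 0.
  have [n] := ubnP (size s); elim: n s => // n IH [|u s] /=; first by rewrite /total big_nil.
  move=> sn s0; rewrite /total (bigID (fun v => v.1 == u.1)) /= [X in X + _]s0 add0r.
  rewrite -big_filter; apply: IH => [|d].
    rewrite ltnS in sn; rewrite /= eqxx /=; apply: leq_ltn_trans sn.
    by rewrite size_filter count_size.
  rewrite /coeffs big_filter_cond; have [->|du] := eqVneq d u.1.
    by rewrite big1_seq // => v; case: eqP.
  rewrite -[RHS](s0 d); apply: eq_bigl => v.
  by case: (eqVneq v.1 d) => [->|]; rewrite ?du ?andbF.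
have shift_delta m b n x : shift m b (delta n x) = delta (n + m) (b * x).
  apply/funext => d; rewrite /shift /delta subr_eq.
  by case: ifP => _; rewrite ?mulr0.
have act1 f : act 1 f = f.
  rewrite -sum_vtx (big_morph (act^~ f) (id1 := 0) (op1 := +%R)) //.
  apply/funext => d; rewrite fct_sumE.
  under eq_bigr do rewrite av /shift subr0.
  by rewrite -mulr_suml sum_vtx mul1r.
have act_path b n x : act (path_elt k b) (delta n x) = delta (n + (size b)%:Z) (path_elt k b * x).
  elim: b n x => [|b q IH] n x /=; first by rewrite act1 addr0 mul1r.
  by rewrite aM IH aa shift_delta mulrA -addrA -PoszD addn1.
pose tau (f : int -> L) : int -> L := fun d => f (d - l) * c.
have shift_tau n b f : shift n b (tau f) = tau (shift n b f).
  by apply/funext => d; rewrite /shift /tau mulrA addrAC.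
have act_tau b : forall f, act b (tau f) = tau (act b f).
  elim/leavitt_ind: b => [f|i f|[b|b] f|x y IHx IHy f|e x IHx f|x y IHx IHy f].
  - by rewrite !act0; apply/funext => d; rewrite /tau mul0r.
  - by rewrite !av shift_tau.
  - by rewrite !aa shift_tau.
  - by rewrite !ag shift_tau.
  - by rewrite !aDl IHx IHy; apply/funext => d; rewrite /tau mulrDl.
  - by rewrite !aZ IHx shift_tau.
  - by rewrite !aM IHy IHx.
pose F := act a (delta 0 1).
have FE d : F d = F (d - l) * c.
  rewrite -/(tau F d) -act_tau /F {1}ap aM act_path; congr (act a _ d).
  apply/funext => e; rewrite /tau /delta add0r mulr1 subr_eq0 /l.
  by case: ifP => _; rewrite ?mul1r ?mul0r.
have [s' s'E <-] : exists2 s', F = coeffs s' & total s' = a.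
  have [s' s'E s't] := act_coeffs a [:: (0, 1)]; exists s'.
    rewrite -s'E; congr act; apply/funext => d.
    by rewrite /coeffs big_mkcond big_seq1 eq_sym.
  by rewrite s't /total big_seq1 mulr1.
apply: total0 => d; rewrite -s'E.
have [M MP] : exists M : nat, forall u, u \in s' -> (- M%:Z <= u.1)%R.
  elim: s' {s'E} => [|u s' [M MP]]; first by exists 0%N.
  have bound1 (z : int) : (- (M + `|z|)%N%:Z <= z)%R by lia.
  have bound2 (z w : int) : (- M%:Z <= w -> - (M + `|z|)%N%:Z <= w)%R by lia.
  exists (M + `|u.1|)%N => v; rewrite inE => /orP[/eqP ->|/MP]; first exact: bound1.
  exact: bound2.
have Fbound (j : nat) : forall d, (d < - M%:Z + j%:Z)%R -> F d = 0.
  elim: j => [|j IH] e ej.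
    rewrite s'E /coeffs big1_seq // => u /andP[/eqP ue /MP]; rewrite ue => eM; exfalso; lia.
  rewrite FE IH ?mul0r // /l.
  by have : (0 < size p)%N; [rewrite lt0n size_eq0|lia].
by apply: (Fbound (`|d| + M + 1)%N); lia.
Qed.

End Grading.

(** * Split sequences in tensor products *)

Section SplitSequences.
Variable k : fieldType.

(** The elements x_0, ..., x_(m-1) form a regular sequence for right
    multiplication, in the strong sense that linear retractions are given which
    are compatible with the other elements; the functional [lam] shows that the
    right ideal generated by the x_i is proper. *)
Record split_sequence (B : kalgType k) (m : nat) (x : nat -> B) (rho : nat -> B -> B)
    (lam : B -> k) : Prop := SplitSequence {
  seqC : forall i j, (i < m)%N -> (j < m)%N -> x i * x j = x j * x i;
  rhoD : forall i, (i < m)%N -> {morph rho i : b c / b + c};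
  rhoZ : forall i c b, (i < m)%N -> rho i (scal c * b) = scal c * rho i b;
  rhoK : forall i b, (i < m)%N -> rho i (b * x i) = b;
  rhoM : forall i j b, (i < m)%N -> (j < m)%N -> i != j ->
    rho i (b * x j) = rho i b * x j;
  lamD : {morph lam : b c / b + c};
  lamZ : forall c b, lam (scal c * b) = c * lam b;
  lam1 : lam 1 = 1;
  lam_seq : forall i b, (i < m)%N -> lam (x i * b) = 0 }.

Definition has_split_sequence (B : kalgType k) (m : nat) : Prop :=
  exists x rho lam, @split_sequence B m x rho lam.

Lemma leavitt_split_sequence (E : quiver) :
  has_nontrivial_closed_path E -> has_split_sequence (leavitt k E) 1.
Proof.
move=> [a [p [pP ap]]]; set c := path_elt k (a :: p).
have [lam [lD lZ l1 lc]] := evaluation_functional k pP ap.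
have [||b|rho [rD rZ rK]] := @linear_retraction _ (leavitt k E) (fun b => b * (1 - c)).
- by move=> b b'; rewrite mulrDl.
- by move=> e b; rewrite mulrA.
- rewrite mulrBr mulr1 => /eqP; rewrite subr_eq0 => /eqP.
  exact: path_elt_not_right_zero_divisor.
exists (fun=> 1 - c), (fun=> rho), lam; split=> //.
by move=> [|i] [|j].
Qed.

Lemma tensor_map (A B : kalgType k) (f : A -> A) (g : B -> B) :
  {morph f : a b / a + b} -> (forall c a, f (scal c * a) = scal c * f a) ->
  {morph g : a b / a + b} -> (forall c a, g (scal c * a) = scal c * g a) ->
  exists h : tensor A B -> tensor A B,
    {morph h : s t / s + t} /\ forall a b, h (pure a b) = pure (f a) (g b).
Proof.
move=> fD fZ gD gZ; pose psi a b := pure (f a) (g b) : tensor A B.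
have h1 a a' b : psi (a + a') b = psi a b + psi a' b by rewrite /psi fD pureDl.
have h2 a b b' : psi a (b + b') = psi a b + psi a b' by rewrite /psi gD pureDr.
have h3 a c b : psi (a * scal c) b = psi a (scal c * b).
  by rewrite /psi -scalC fZ gZ scalC pure_bal.
exists (bt_lift psi); split=> [s t|a b]; first exact: bt_liftD.
exact: bt_liftE.
Qed.

(** One element comes from [A] and the others from [B], so the new relations
    between them hold because they act on different tensor factors. *)
Lemma tensor_split_sequence (A B : kalgType k) (m : nat) :
  has_split_sequence A 1 -> has_split_sequence B m ->
  has_split_sequence (tensor A B) m.+1.
Proof.
move=> [x [rho [lam xP]]] [y [sigma [mu yP]]].
have lt01 : (0 < 1)%N by [].
have [r [rD rE]] := @tensor_map A B _ id (rhoD xP lt01) (fun c a => rhoZ xP c a lt01)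
  (fun b b' : B => erefl) (fun c b => erefl).
have sE (j : nat) : exists h : tensor A B -> tensor A B, (j < m)%N ->
    {morph h : s t / s + t} /\ forall a b, h (pure a b) = pure a (sigma j b).
  have [jm|_] := boolP (j < m)%N; last by exists id.
  have [h [hD hE]]   := @tensor_map A B id _ (fun a a' : A => erefl) (fun c a => erefl)
    (rhoD yP jm) (fun c b => rhoZ yP c b jm).
  by exists h.
have {sE} [s sP] := choice sE.
pose psi a b := lam a * mu b.
have p1 a a' b : psi (a + a') b = psi a b + psi a' b by rewrite /psi (lamD xP) mulrDl.
have p2 a b b' : psi a (b + b') = psi a b + psi a b' by rewrite /psi (lamD yP) mulrDr.
have p3 a c b : psi (a * scal c) b = psi a (scal c * b).
  by rewrite /psi -scalC (lamZ xP) (lamZ yP) mulrA [c * _]mulrC.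
pose nu : tensor A B -> k := bt_lift psi.
have nuD : {morph nu : s t / s + t} by move=> u v; apply: bt_liftD.
have nuE a b : nu (pure a b) = lam a * mu b by apply: bt_liftE.
pose z (j : nat) : tensor A B := if j is j.+1 then pure 1 (y j) else pure (x 0) 1.
exists z, (fun j => if j is j.+1 then s j else r), nu; split=> //.
- move=> [|i] [|j] //= im jm; rewrite !pureM ?mulr1 ?mul1r //.
  by rewrite (seqC yP).
- by move=> [|i] im //=; have [] := sP i im.
- move=> [|i] c t im; elim/(@tensor_ind k A B): t => [a b|u v IHu IHv].
  + by rewrite pureM !rE (rhoZ xP) // pureM !mul1r.
  + by rewrite mulrDr !rD mulrDr IHu IHv.
  + by have [sD sE] := sP i im; rewrite pureM !sE pureM mul1r mul1r.
  + by have [sD sE] := sP i im; rewrite mulrDr !sD mulrDr IHu IHv.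
- move=> [|i] t im /=; elim/(@tensor_ind k A B): t => [a b|u v IHu IHv].
  + by rewrite pureM rE (rhoK xP) // mulr1.
  + by rewrite mulrDl rD IHu IHv.
  + by have [sD sE] := sP i im; rewrite pureM sE (rhoK yP) // mulr1.
  + by have [sD sE] := sP i im; rewrite mulrDl sD IHu IHv.
- move=> [|i] [|j] t im jm ij //=; elim/(@tensor_ind k A B): t => [a b|u v IHu IHv].
  + by rewrite pureM !rE pureM !mulr1.
  + by rewrite mulrDl !rD mulrDl IHu IHv.
  + by have [sD sE] := sP i im; rewrite pureM !sE pureM !mulr1.
  + by have [sD sE] := sP i im; rewrite mulrDl !sD mulrDl IHu IHv.
  + by have [sD sE] := sP i im; rewrite pureM !sE pureM !mulr1 (rhoM yP).
  + by have [sD sE] := sP i im; rewrite mulrDl !sD mulrDl IHu IHv.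
- move=> c t; elim/(@tensor_ind k A B): t => [a b|u v IHu IHv].
    by rewrite pureM !nuE (lamZ xP) mul1r mulrA.
  by rewrite mulrDr !nuD IHu IHv mulrDr.
- by rewrite nuE (lam1 xP) (lam1 yP) mulr1.
- move=> [|i] t im; elim/(@tensor_ind k A B): t => [a b|u v IHu IHv].
  + by rewrite pureM nuE (lam_seq xP) // mul0r.
  + by rewrite mulrDr nuD IHu IHv addr0.
  + by rewrite pureM nuE (lam_seq yP) // mulr0.
  + by rewrite mulrDr nuD IHu IHv addr0.
Qed.

End SplitSequences.

(** * Koszul complexes of commuting endomorphisms *)

Section Koszul.
Variables (R : pzRingType) (P : lmodType R).

(** The term of degree i in the Koszul complex on m endomorphisms of [P], built
    as an iterated mapping cone: the cone of an endomorphism of K is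
    K_(i+1) + K_i in degree i+1. *)
Fixpoint kos (m i : nat) : lmodType R :=
  match m, i with
  | 0, 0 => P
  | 0, _.+1 => {ffun 'I_0 -> P}
  | m.+1, 0 => kos m 0
  | m.+1, i.+1 => (kos m i.+1 * kos m i)%type
  end.

Fixpoint kos_map (f : P -> P) (m i : nat) : kos m i -> kos m i :=
  match m, i with
  | 0, 0 => f
  | 0, _.+1 => id
  | m.+1, 0 => @kos_map f m 0
  | m.+1, i.+1 => fun u => (@kos_map f m i.+1 u.1, @kos_map f m i u.2)
  end.

Fixpoint kos_top (m : nat) : P -> kos m m :=
  match m with
  | 0 => id
  | m.+1 => fun p => (0, kos_top m p)
  end.

Fixpoint kos_proj (m : nat) : kos m m -> P :=
  match m with
  | 0 => id
  | m.+1 => fun u => @kos_proj m u.2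
  end.

Lemma kos_topK m p : kos_proj (kos_top m p) = p.
Proof. by elim: m. Qed.

Lemma kos_eq0 m i (u : kos m i) : (m < i)%N -> u = 0.
Proof.
elim: m i u => [|m IH] [|i] //= u; first by move=> _; apply/ffunP => -[].
case: u => u v mi; congr (_, _); apply: IH => //; exact: ltnW.
Qed.

Lemma kos_topD m : {morph kos_top m : p q / p + q}.
Proof. by elim: m => //= m IH p q; rewrite IH; congr (_, _); rewrite addr0. Qed.

Lemma kos_topZ m t p : kos_top m (t *: p) = t *: kos_top m p.
Proof. by elim: m => //= m IH; rewrite IH; congr (_, _); rewrite scaler0. Qed.

Lemma kos_map_top f m p : {morph f : p q / p + q} ->
  kos_map f (kos_top m p) = kos_top m (f p).
Proof.
move=> fD; elim: m => //= m ->; congr (_, _).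
by apply/kos_eq0/ltnSn.
Qed.

Section Map.
Variable f : P -> P.

Lemma kos_mapD m i : {morph f : p q / p + q} -> {morph @kos_map f m i : u v / u + v}.
Proof.
move=> fD; elim: m i => [|m IH] [|i] //=.
by move=> u v; congr (_, _); apply: IH.
Qed.

Lemma kos_mapZ t m i : (forall p, f (t *: p) = t *: f p) ->
  forall u, @kos_map f m i (t *: u) = t *: kos_map f u.
Proof.
move=> ft; elim: m i => [|m IH] [|i] //=.
by move=> u; congr (_, _); apply: IH.
Qed.

Lemma kos_map_comm g m i : (forall p, f (g p) = g (f p)) ->
  forall u, @kos_map f m i (kos_map g u) = kos_map g (kos_map f u).
Proof.
move=> fg; elim: m i => [|m IH] [|i] //=.
by move=> u; congr (_, _); apply: IH.
Qed.

Lemma kos_mapK g m i : cancel f g -> cancel (@kos_map f m i) (@kos_map g m i).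
Proof.
move=> fg; elim: m i => [|m IH] [|i] //=.
by case=> u v; congr (_, _); apply: IH.
Qed.

End Map.

Variable X : nat -> P -> P.
Hypothesis XD : forall j, {morph X j : p q / p + q}.
Hypothesis XC : forall i j p, X i (X j p) = X j (X i p).

Fixpoint kos_d (m : nat) : forall i, kos m i.+1 -> kos m i :=
  match m with
  | 0 => fun _ _ => 0
  | m.+1 => fun i =>
    match i with
    | 0 => fun u => @kos_d m 0 u.1 + kos_map (X m) u.2
    | i.+1 => fun u => (@kos_d m i.+1 u.1 + kos_map (X m) u.2, - @kos_d m i u.2)
    end
  end.

Lemma kos_dD m i : {morph @kos_d m i : u v / u + v}.
Proof.
elim: m i => [|m IH] [|i] u v //=; rewrite ?addr0 // ?IH ?(kos_mapD (XD m)).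
  by rewrite addrACA.
by congr (_, _); rewrite ?opprD // addrACA.
Qed.

Lemma kos_dZ t m i : (forall j p, X j (t *: p) = t *: X j p) ->
  forall u, @kos_d m i (t *: u) = t *: kos_d u.
Proof.
move=> Xt; elim: m i => [|m IH] [|i] u //=; rewrite ?scaler0 // ?IH ?(kos_mapZ (Xt m)).
  by rewrite scalerDr.
by congr (_, _); rewrite /= ?scalerDr ?scalerN.
Qed.

Lemma kos_d_map f m i : {morph f : p q / p + q} ->
  (forall j, (j < m)%N -> forall p, f (X j p) = X j (f p)) ->
  forall u, kos_map f (@kos_d m i u) = kos_d (kos_map f u).
Proof.
move=> fD; elim: m i => [|m IH] [|i] fX u //=.
- exact: addm0.
- rewrite (kos_mapD fD) IH => [|j jm]; last exact/fX/ltnW.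
  by rewrite (kos_map_comm (fX m (ltnSn m))).
- have fX' j (jm : (j < m)%N) := fX j (ltnW jm).
  congr (_, _); last by rewrite (addmN (kos_mapD fD)) IH.
  by rewrite (kos_mapD fD) IH // (kos_map_comm (fX m (ltnSn m))).
Qed.

Lemma kos_dd m i (u : kos m i.+2) : kos_d (kos_d u) = 0.
Proof.
elim: m i u => [|m IH] i; first by [].
have XCm j : (j < m)%N -> forall p, X m (X j p) = X j (X m p) by [].
case: i => [|i] [u v] /=.
  rewrite (@kos_dD _ _) IH add0r (addmN (kos_mapD (XD m))) (kos_d_map (XD m) XCm).
  by rewrite subrr.
congr (_, _); last by rewrite (addmN (@kos_dD _ _)) IH !oppr0.
rewrite (@kos_dD _ _) IH add0r (addmN (kos_mapD (XD m))) (kos_d_map (XD m) XCm).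
by rewrite subrr.
Qed.

(** The last differential sends p to the tuple of the elements X_j p, up to
    sign; the signs are absorbed in the maps G_j. *)
Lemma kos_d_top (S : R -> Prop) i (H : kos i.+1 i -> P) :
  {morph H : u v / u + v} -> (forall t u, S t -> H (t *: u) = t *: H u) ->
  exists G : nat -> P -> P,
  [/\ forall j, {morph G j : p q / p + q},
      forall j t p, S t -> G j (t *: p) = t *: G j p &
      forall p, H (kos_d (kos_top i.+1 p)) = \sum_(j < i.+1) G j (X j p)].
Proof.
elim: i H => [|i IH] H HD HZ.
  exists (fun=> H); split=> // p; by rewrite big_ord1 /= add0r.
have [|t u St|G [GD GZ GE]] := IH (fun v => H (0, - v)).
- by move=> u v; rewrite -HD opprD; congr (H (_, _)); rewrite addr0.
- by rewrite -HZ //; congr (H (_, _)); rewrite /= ?scaler0 ?scalerN.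
pose G' p := H (kos_top i.+1 p, 0).
exists (fun j => if j == i.+1 then G' else G j); split=> [j p q|j t p St|p].
- case: ifP => _; last exact: GD.
  rewrite /G' -HD kos_topD; congr (H (_, _)).
  by rewrite addr0.
- case: ifP => _; last exact: GZ.
  by rewrite /G' -HZ // kos_topZ; congr (H (_, _)); rewrite /= scaler0.
rewrite big_ord_recr /= eqxx.
have -> : \sum_(j < i.+1) (if j == i.+1 :> nat then G' else G j) (X j p) =
    H (0, - kos_d (kos_top i.+1 p)).
  by rewrite GE; apply: eq_bigr => j _; rewrite ltn_eqF.
rewrite -HD; congr (H (_, _)); last by rewrite addr0.
rewrite /= add0r -[RHS]/(kos_top i.+1 (X i.+1 p)) -(kos_map_top i.+1 p (XD _)).
by rewrite -[RHS]add0r; congr (_ + _); apply: (addm0 (@kos_dD i.+1 i.+1)).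
Qed.

Variable rho : nat -> P -> P.
Hypothesis rhoD : forall j, {morph rho j : p q / p + q}.
Hypothesis rhoK : forall j, cancel (X j) (rho j).
Hypothesis rhoC : forall i j p, i != j -> rho i (X j p) = X j (rho i p).

(** On the cone of x, with r a retraction of x and h a homotopy for the complex
    on the preceding endomorphisms, the homotopy is
    (u, v) |-> (h u - x r h u, r u). *)
Fixpoint kos_h (m : nat) : forall i, kos m i -> kos m i.+1 :=
  match m with
  | 0 => fun _ _ => 0
  | m.+1 => fun i =>
    match i with
    | 0 => fun u => let w := @kos_h m 0 u in
        (w - kos_map (X m) (kos_map (rho m) w), kos_map (rho m) u)
    | i.+1 => fun u => let w := @kos_h m i.+1 u.1 in
        (w - kos_map (X m) (kos_map (rho m) w), kos_map (rho m) u.1)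
    end
  end.

Lemma kos_hD m i : {morph @kos_h m i : u v / u + v}.
Proof.
elim: m i => [|m IH] [|i] u v //=; rewrite ?addr0 //; congr (_, _).
1,3: by rewrite IH !(kos_mapD (rhoD m), kos_mapD (XD m)) opprD addrACA.
all: exact: kos_mapD.
Qed.

Lemma kos_hZ t m i : (forall j p, X j (t *: p) = t *: X j p) ->
  (forall j p, rho j (t *: p) = t *: rho j p) ->
  forall u, @kos_h m i (t *: u) = t *: kos_h u.
Proof.
move=> Xt rt; elim: m i => [|m IH] [|i] u //=; rewrite ?scaler0 //; congr (_, _).
1,3: by rewrite IH !(kos_mapZ (rt m), kos_mapZ (Xt m)) scalerBr.
all: exact: kos_mapZ.
Qed.

Lemma kos_h_map f m i : {morph f : p q / p + q} ->
  (forall j, (j < m)%N -> forall p, f (X j p) = X j (f p)) ->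
  (forall j, (j < m)%N -> forall p, f (rho j p) = rho j (f p)) ->
  forall u, kos_map f (@kos_h m i u) = kos_h (kos_map f u).
Proof.
move=> fD; elim: m i => [|m IH] i fX fr u; first exact: kos_eq0.
have fX' j (jm : (j < m)%N) := fX j (ltnW jm).
have fr' j (jm : (j < m)%N) := fr j (ltnW jm).
have fXm := fX m (ltnSn m); have frm := fr m (ltnSn m).
case: i u => [|i] u /=; congr (_, _); rewrite ?(kos_map_comm frm) //.
all: rewrite (addmB (kos_mapD fD)) (kos_map_comm fXm) (kos_map_comm frm).
all: by rewrite IH.
Qed.

Lemma kos_homotopy m i (u : kos m i.+1) : kos_h (kos_d u) + kos_d (kos_h u) = u.
Proof.
elim: m i u => [|m IH] i u; first by rewrite [LHS]kos_eq0 // [RHS]kos_eq0.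
pose x n : kos m n -> kos m n := @kos_map (X m) m n.
pose r n : kos m n -> kos m n := @kos_map (rho m) m n.
have xD n : {morph @x n : v w / v + w} := kos_mapD (XD m).
have rD n : {morph @r n : v w / v + w} := kos_mapD (rhoD m).
have hD := kos_hD; have dD := kos_dD.
have XX j : (j < m)%N -> forall p, X m (X j p) = X j (X m p) by [].
have rX j : (j < m)%N -> forall p, rho m (X j p) = X j (rho m p).
  by move=> jm p; rewrite rhoC // gtn_eqF.
have Xr j : (j < m)%N -> forall p, X m (rho j p) = rho j (X m p).
  by move=> jm p; rewrite rhoC // ltn_eqF.
have rx n : cancel (@x n) (@r n) := kos_mapK (rhoK m).
have dx n (v : kos m n.+1) : kos_d (x _ v) = x _ (kos_d v).
  by rewrite /x (kos_d_map (XD m) XX).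
have dr n (v : kos m n.+1) : kos_d (r _ v) = r _ (kos_d v).
  by rewrite /r (kos_d_map (rhoD m) rX).
have hx n (v : kos m n) : kos_h (x _ v) = x _ (kos_h v).
  by rewrite /x (kos_h_map (XD m) XX Xr).
have cone (v : kos m i.+1) (w : kos m i) :
    kos_h (kos_d v + x _ w) - x _ (r _ (kos_h (kos_d v + x _ w)))
    + (kos_d (kos_h v - x _ (r _ (kos_h v))) + x _ (r _ v)) = v.
  have hdv : kos_h (kos_d v) = v - kos_d (kos_h v).
    by apply/eqP; rewrite eq_sym subr_eq IH.
  rewrite hD hx hdv !(rD, xD) rx (addmB (@dD _ _)) dx dr.
  rewrite !(addmN (@rD _), addmN (@xD _)).
  set a := kos_d (kos_h v); set b := x _ (r _ v); set c := x _ (kos_h w).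
  set e := x _ (r _ a).
  have -> : v - a + c - (b - e + c) = v - a - (b - e).
    by rewrite opprD addrACA subrr addr0.
  have -> : a - e + b = a + (b - e) by rewrite addrAC addrA.
  by rewrite [a + _]addrC addrA subrK subrK.
case: i u cone => [|i] [v w] cone /=; congr (_, _); rewrite ?cone //.
all: by rewrite /= -/(r _ _) rD -/(x _ _) rx -dr addrAC subrr add0r.
Qed.

End Koszul.

Section KoszulSplitting.
Variables (k : fieldType) (A R : kalgType k) (iota : A -> R) (T : R -> Prop).

Lemma splitting_prod (K K' : lmodType R) s s' :
  @splitting k A R iota T K s -> @splitting k A R iota T K' s' ->
  exists s'' : K * K' -> seq (A * (K * K')), splitting iota T s''.
Proof.
move=> sP sP'.
pose inl' (u : A * K) : A * (K * K') := (u.1, (u.2, 0)).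
pose inr' (u : A * K') : A * (K * K') := (u.1, (0, u.2)).
pose s'' (v : K * K') := map inl' (s v.1) ++ map inr' (s' v.2).
have s''E (G : zmodType) (phi : A -> K * K' -> G) v :
    ext phi (s'' v) = ext (fun a x => phi a (x, 0)) (s v.1)
                    + ext (fun a y => phi a (0, y)) (s' v.2).
  by rewrite /ext big_cat !big_map.
have bl (G : zmodType) (phi : A -> K * K' -> G) :
    balanced phi -> balanced (fun a x => phi a (x, 0)).
  move=> phiP; split=> [a b x|a x y|a c x]; first exact: (balDl phiP).
    by rewrite -(balDr phiP); congr (phi a (_, _)); rewrite addr0.
  by rewrite (balZ phiP); congr (phi a (_, _)); rewrite scaler0.
have br (G : zmodType) (phi : A -> K * K' -> G) :
    balanced phi -> balanced (fun a y => phi a (0, y)).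
  move=> phiP; split=> [a b x|a x y|a c x]; first exact: (balDl phiP).
    by rewrite -(balDr phiP); congr (phi a (_, _)); rewrite addr0.
  by rewrite (balZ phiP); congr (phi a (_, _)); rewrite scaler0.
exists s''; split=> [G phi phiP x y|G phi phiP a x|G phi phiP t x Tt|[x y]]; rewrite !s''E.
- rewrite (splD sP (bl _ _ phiP)) (splD sP' (br _ _ phiP)).
  by rewrite addrACA.
- by rewrite (splM sP (bl _ _ phiP)) (splM sP' (br _ _ phiP)).
- rewrite (splT sP (bl _ _ phiP)) // (splT sP' (br _ _ phiP)) //.
  by congr (_ + _); apply: eq_ext => b z; congr (phi b (_, _)); rewrite scaler0.
- have fstD : {morph (fun x => (x, 0) : K * K') : x y / x + y}.
    by move=> u v; congr (_, _); rewrite addr0.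
  have sndD : {morph (fun y => (0, y) : K * K') : x y / x + y}.
    by move=> u v; congr (_, _); rewrite addr0.
  rewrite -{3}(splK sP x) -{3}(splK sP' y).
  transitivity ((ext (fun a y => iota a *: y) (s x), 0) +
     (0, ext (fun a y => iota a *: y) (s' y)) : K * K')%R; last first.
    by congr (_, _); rewrite /= ?addr0 ?add0r.
  rewrite (ext_morph _ _ fstD) (ext_morph _ _ sndD); congr (_ + _).
    by apply: eq_ext => a z; congr (_, _); rewrite scaler0.
  by apply: eq_ext => a z; congr (_, _); rewrite scaler0.
Qed.

Lemma splitting_kos (P : lmodType R) s : @splitting k A R iota T P s ->
  forall m i, exists s' : kos P m i -> seq (A * kos P m i), splitting iota T s'.
Proof.
move=> sP; elim=> [|m IH] [|i]; [by exists s| |exact: IH|].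
  exists (fun=> [::]); split=> [G phi phiP x y|G phi phiP a x|G phi phiP t x Tt|x].
  - by rewrite /ext !big_nil addr0.
  - by rewrite /ext !big_nil.
  - by rewrite /ext !big_nil.
  - by rewrite /ext big_nil; apply/ffunP => -[].
have [s1 s1P] := IH i.+1; have [s2 s2P] := IH i.
exact: splitting_prod s1P s2P.
Qed.

End KoszulSplitting.

(** * Bimodules implementing a Morita equivalence *)

Section MiddleLinear.
Variables (k : fieldType) (R S T : kalgType k).
Variables (P : lmodType (tensor R S^c)) (Q : lmodType (tensor S T^c)).

Record middle_linear (G : zmodType) (psi : P -> Q -> G) : Prop := MiddleLinear {
  midDl : forall p p' q, psi (p + p') q = psi p q + psi p' q;
  midDr : forall p q q', psi p (q + q') = psi p q + psi p q';
  midB : forall p s q, psi (rmul p s) q = psi p (lmul s q) }.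

Lemma bimod_tensor_sum (x : bimod_tensor P Q) :
  exists z : seq (P * Q), x = \sum_(u <- z) bpure u.1 u.2.
Proof.
elim/bimod_tensor_ind: x => [p q|_ _ [z ->] [z' ->]].
  by exists [:: (p, q)]; rewrite big_seq1.
by exists (z ++ z'); rewrite big_cat.
Qed.

(** An equation between pure tensors may be read through every biadditive
    balanced map. *)
Lemma middle_linear_sum (G : zmodType) (psi : P -> Q -> G) p q z :
  middle_linear psi -> bpure p q = \sum_(u <- z) bpure u.1 u.2 ->
  psi p q = \sum_(u <- z) psi u.1 u.2.
Proof.
move=> [Dl Dr B] pqE; pose h : bimod_tensor P Q -> G := bt_lift psi.
have hE p' q' : h (bpure p' q') = psi p' q' by apply: bt_liftE.
have hD : {morph h : x y / x + y} by move=> x y; apply: bt_liftD.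
by rewrite -hE pqE (addm_sum hD); apply: eq_bigr => u _; rewrite hE.
Qed.

End MiddleLinear.

Section Pairings.
Variables (k : fieldType) (R S : kalgType k).
Variables (P : lmodType (tensor R S^c)) (Q : lmodType (tensor S R^c)).

(** The pairing defined by an isomorphism of P (x) Q with R, and the element z
    of P (x) Q that it sends to 1.  The two expansions express that an element
    t of P (x) Q with image r equals both r z and z r. *)
Record perfect_pairing (phi : P -> Q -> R) (z : seq (P * Q)) : Prop := PerfectPairing {
  pairM : middle_linear phi;
  pairL : forall r p q, phi (lmul r p) q = r * phi p q;
  pairR : forall p q r, phi p (rmul q r) = phi p q * r;
  pair1 : \sum_(u <- z) phi u.1 u.2 = 1;
  pair_expandl : forall (G : zmodType) (psi : P -> Q -> G), middle_linear psi ->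
    forall p q, psi p q = \sum_(u <- z) psi (lmul (phi p q) u.1) u.2;
  pair_expandr : forall (G : zmodType) (psi : P -> Q -> G), middle_linear psi ->
    forall p q, psi p q = \sum_(u <- z) psi u.1 (rmul u.2 (phi p q)) }.

Lemma lmod_iso_pairing : lmod_iso (bimod_tensor P Q) (regbimod R) ->
  exists phi z, perfect_pairing phi z.
Proof.
move=> [f [g gf fg]]; pose phi p q : R := f (bpure p q).
have fE r p q r' : f (bpure (lmul r p) (rmul q r')) = (r * phi p q * r' : R).
  by rewrite -bimod_tensor_scaleE; apply: etrans (linearZ _ _) (regbimod_scaleE _ _ _).
have phiL r p q : phi (lmul r p) q = r * phi p q.
  by have := fE r p q 1; rewrite rmul1 mulr1.
have phiR p q r : phi p (rmul q r) = phi p q * r.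
  by have := fE 1 p q r; rewrite lmul1 mul1r.
have fD : {morph f : x y / x + y} by exact: raddfD.
have [z zE] := bimod_tensor_sum (g 1).
have f1 : \sum_(u <- z) phi u.1 u.2 = 1 :> R by rewrite -(addm_sum fD) -zE fg.
exists phi, z; split=> //.
- split=> [p p' q|p q q'|p s q].
  + by rewrite /phi bpureDl fD.
  + by rewrite /phi bpureDr fD.
  + by rewrite /phi bpure_bal.
- move=> G psi psiP p q.
  rewrite (middle_linear_sum (z := [seq (lmul (phi p q) u.1, u.2) | u <- z]) psiP).
    by rewrite big_map.
  apply: (can_inj gf); rewrite big_map (addm_sum fD).
  transitivity (phi p q * 1 : R); first by rewrite mulr1.
  by rewrite -f1 mulr_sumr; apply: eq_bigr => u _; rewrite -phiL.
- move=> G psi psiP p q.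
  rewrite (middle_linear_sum (z := [seq (u.1, rmul u.2 (phi p q)) | u <- z]) psiP).
    by rewrite big_map.
  apply: (can_inj gf); rewrite big_map (addm_sum fD).
  transitivity (1 * phi p q : R); first by rewrite mul1r.
  by rewrite -f1 mulr_suml; apply: eq_bigr => u _; rewrite -phiR.
Qed.

End Pairings.

Section MoritaBimodule.
Variables (k : fieldType) (R S : kalgType k).

(** P is finitely generated projective on both sides, with dual bases
    (F, w) and (u, G), and its left endomorphisms are the right
    multiplications. *)
Record invertible_bimodule (P : lmodType (tensor R S^c))
    (N N' : nat) (F : 'I_N -> P -> R) (w : 'I_N -> P)
    (u : 'I_N' -> P) (G : 'I_N' -> P -> S) : Prop := InvertibleBimodule {
  lbD : forall i, {morph F i : p q / p + q};
  lbL : forall i r p, F i (lmul r p) = r * F i p;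
  lbE : forall p, \sum_i lmul (F i p) (w i) = p;
  rbD : forall i, {morph G i : p q / p + q};
  rbR : forall i p s, G i (rmul p s) = G i p * s;
  rbE : forall p, \sum_i rmul (u i) (G i p) = p;
  endE : forall H : P -> P, {morph H : p q / p + q} ->
    (forall r p, H (lmul r p) = lmul r (H p)) -> exists s, forall p, H p = rmul p s;
  faithful : forall s, (forall p : P, rmul p s = p) -> s = 1 }.

(** The two pairings need not be compatible: p (psi q p') and (phi p q) p' may
    differ.  They differ by the bijection theta of P, which is linear on the
    left and whose inverse theta' is linear on the right, and inserting these
    bijections repairs the classical formulas for the dual bases. *)
Lemma morita_invertible : morita_equivalent R S ->
  exists P N N' F w u G, @invertible_bimodule P N N' F w u G.
Proof.
move=> [P [Q [/lmod_iso_pairing[phi [z phiP]] /lmod_iso_pairing[psi [z' psiP]]]]].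
have [phiDl phiDr phiB] := pairM phiP; have [psiDl psiDr psiB] := pairM psiP.
have lmulD r : {morph @lmul _ _ _ P r : p p' / p + p'} by move=> p p'; exact: lmulDr.
have rmulD s : {morph (fun p : P => rmul p s) : p p' / p + p'}.
  by move=> p p'; exact: rmulDl.
pose theta p := \sum_(u <- z) rmul u.1 (psi u.2 p).
pose theta' p := \sum_(v <- z') lmul (phi p v.1) v.2.
have thetaD : {morph theta : p p' / p + p'}.
  move=> p p'; rewrite -big_split; apply: eq_bigr => u _ /=.
  by rewrite psiDr rmulDr.
have theta'D : {morph theta' : p p' / p + p'}.
  move=> p p'; rewrite -big_split; apply: eq_bigr => u _ /=.
  by rewrite phiDl lmulDl.
have mid' p : middle_linear (fun (q : Q) (p' : P) => lmul (phi p q) p').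
  split=> [q q' p'|q p' p''|q r p'].
  - by rewrite phiDr lmulDl.
  - by rewrite lmulDr.
  - by rewrite (pairR phiP) lmulA.
have mid p' : middle_linear (fun (p : P) (q : Q) => rmul p (psi q p')).
  split=> [p p1 q|p q q'|p s q].
  - by rewrite rmulDl.
  - by rewrite psiDl rmulDr.
  - by rewrite (pairL psiP) rmulA.
have E1 p q p' : lmul (phi p q) p' = rmul (theta' p) (psi q p').
  rewrite (pair_expandr psiP (mid' p)) (addm_sum (rmulD _)).
  by apply: eq_bigr => v _; rewrite lrmulC.
have E2 p q p' : lmul (phi p q) p' = theta' (rmul p (psi q p')).
  rewrite (pair_expandl psiP (mid' p)); apply: eq_bigr => v _.
  by rewrite phiB.
have E3 p q p' : rmul p (psi q p') = theta (lmul (phi p q) p').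
  rewrite (pair_expandr phiP (mid p')); apply: eq_bigr => u _.
  by rewrite psiB.
have E4 p q p' : rmul p (psi q p') = lmul (phi p q) (theta p').
  rewrite (pair_expandl phiP (mid p')) (addm_sum (lmulD _)).
  by apply: eq_bigr => u _; rewrite lrmulC.
have psi_span s : s = \sum_(v <- z') psi v.1 (rmul v.2 s).
  rewrite -[LHS]mul1r -(pair1 psiP) mulr_suml; apply: eq_bigr => v _.
  by rewrite (pairR psiP).
have phi_span r : r = \sum_(u <- z) phi (lmul r u.1) u.2.
  rewrite -[LHS]mulr1 -(pair1 phiP) mulr_sumr; apply: eq_bigr => u _.
  by rewrite (pairL phiP).
have lmul_sum (I : Type) (t : seq I) (F : I -> R) (p : P) :
    lmul (\sum_(i <- t) F i) p = \sum_(i <- t) lmul (F i) p.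
  exact: (addm_sum (f := fun r => lmul r p) (fun r r' => lmulDl r r' p)).
have rmul_sum (I : Type) (t : seq I) (F : I -> S) (p : P) :
    rmul p (\sum_(i <- t) F i) = \sum_(i <- t) rmul p (F i).
  exact: (addm_sum (f := fun s => rmul p s) (fun s s' => rmulDr p s s')).
have thetaL r p : theta (lmul r p) = lmul r (theta p).
  rewrite {1 2}(phi_span r) !lmul_sum (addm_sum thetaD); apply: eq_bigr => u _.
  by rewrite -E3 E4.
have thetaK p : theta' (theta p) = p.
  rewrite (addm_sum theta'D) -[RHS]lmul1 -(pair1 phiP) lmul_sum.
  by apply: eq_bigr => u _; rewrite -E2.
have theta'R p s : theta' (rmul p s) = rmul (theta' p) s.
  rewrite {1 2}(psi_span s) !rmul_sum (addm_sum theta'D); apply: eq_bigr => v _.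
  by rewrite -E2 E1.
pose y (v : 'I_(size z')) := tnth (in_tuple z') v; pose x u := tnth (in_tuple z) u.
exists P, (size z'), (size z), (fun v p => phi (theta p) (y v).1), (fun v => (y v).2),
  (fun u => theta' (x u).1), (fun u => psi (x u).2); split=> //.
- by move=> v p p'; rewrite thetaD phiDl.
- by move=> v r p; rewrite thetaL (pairL phiP).
- move=> p; rewrite -(big_tnth _ _ z' xpredT (fun v => lmul (phi (theta p) v.1) v.2)).
  exact: thetaK.
- by move=> u p p'; rewrite psiDr.
- by move=> u p s; rewrite (pairR psiP).
- move=> p; rewrite -(big_tnth _ _ z xpredT (fun u => rmul (theta' u.1) (psi u.2 p))).
  by rewrite -[RHS]thetaK (addm_sum theta'D); apply: eq_bigr => u _; rewrite theta'R.
- move=> H HD HL; exists (\sum_(v <- z') psi v.1 (H v.2)) => p.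
  rewrite -{1}[p]thetaK (addm_sum HD) rmul_sum; apply: eq_bigr => v _.
  by rewrite HL E1 thetaK.
- move=> s sP; rewrite (psi_span s) -(pair1 psiP); apply: eq_bigr => v _.
  by rewrite sP.
Qed.

End MoritaBimodule.

(** * Comparison of dimensions *)

Lemma dim_le_tensor_seq (k : fieldType) (I : Type) (A : I -> kalgType k) (s : seq I) :
  (forall i, dim_le (A i) 1) -> (0 < size s)%N ->
  dim_le (tensor_seq [seq A i | i <- s]) (size s).
Proof.
move=> dimA; elim: s => // i [|j s] IH _; first exact: dimA.
by rewrite /= -[(size s).+2]add1n; apply: dim_le_tensor; [exact: dimA|exact: IH].
Qed.

Lemma tensor_seq_split_sequence (k : fieldType) (I : Type) (A : I -> kalgType k)
    (s : seq I) :
  (forall i, has_split_sequence (A i) 1) -> (0 < size s)%N ->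
  has_split_sequence (tensor_seq [seq A i | i <- s]) (size s).
Proof.
move=> splA; elim: s => // i [|j s] IH _; first exact: splA.
by apply: tensor_split_sequence; [exact: splA|exact: IH].
Qed.

(** The Koszul complex of the right multiplications by the x_j on P has length
    m; if n < m, an A-linear homotopy that contracts it in degrees greater than
    n splits its last differential. *)
Theorem dim_le_split_sequence (k : fieldType) (A B : kalgType k) (n m : nat) :
  dim_le A n -> has_split_sequence B m -> morita_equivalent A B -> (m <= n)%N.
Proof.
move=> dimA [x [sigma [lam xP]]] /morita_invertible[P [N [N' [F [w [u [G PP]]]]]]].
rewrite leqNgt; apply/negP; case: m xP => // m xP nm.
have lmulD r : {morph @lmul _ _ _ P r : p p' / p + p'} by move=> p p'; exact: lmulDr.
have rmulD s : {morph (fun p : P => rmul p s) : p p' / p + p'}.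
  by move=> p p'; exact: rmulDl.
pose iota (a : A) : tensor A B^c := pure a 1.
pose T (r : tensor A B^c) := exists c : k, r = scal c.
have scalE c (p : P) : (scal c : tensor A B^c) *: p = lmul (scal c) p by [].
(* Identities pad the sequences X and rho beyond their length, so that their
   properties hold for all indices. *)
pose X j (p : P) := if (j < m.+1)%N then rmul p (x j) else p.
pose rho j (p : P) := if (j < m.+1)%N then \sum_i rmul (u i) (sigma j (G i p)) else p.
have XD j : {morph X j : p q / p + q}.
  by move=> p q; rewrite /X; case: ifP => // _; exact: rmulDl.
have XL j a p : X j (lmul a p) = lmul a (X j p).
  by rewrite /X; case: ifP => // _; rewrite lrmulC.
have XC i j p : X i (X j p) = X j (X i p).
  rewrite /X; case: ifP => im; case: ifP => jm //.
  by rewrite !rmulA (seqC xP).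
have rhoD' j : {morph rho j : p q / p + q}.
  move=> p q; rewrite /rho; case: ifP => // jm; rewrite -big_split.
  by apply: eq_bigr => i _; rewrite (rbD PP) (rhoD xP) // rmulDr.
have rhoK' j : cancel (X j) (rho j).
  move=> p; rewrite /X /rho; case jm: (j < m.+1)%N => //; rewrite -[RHS](rbE PP).
  by apply: eq_bigr => i _; rewrite (rbR PP) (rhoK xP).
have rhoC i j p : i != j -> rho i (X j p) = X j (rho i p).
  rewrite /X /rho => ij; case jm: (j < m.+1)%N; case im: (i < m.+1)%N => //.
  rewrite (addm_sum (rmulD _)); apply: eq_bigr => l _.
  by rewrite (rbR PP) (rhoM xP) // rmulA.
have rhoZ' j c p : rho j (lmul (scal c) p) = lmul (scal c) (rho j p).
  rewrite /rho; case: ifP => // jm; rewrite (addm_sum (lmulD _)).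
  apply: eq_bigr => i _; rewrite !lrmul_scal (rbR PP) -scalC (rhoZ xP) // scalC.
  by rewrite rmulA.
have iotaP : kalg_hom iota := pure_homl A B^c.
have TC t a : T t -> t * iota a = iota a * t by case=> c ->; rewrite scalC.
have Tk c : T (scal c) by exists c.
have dP : complex (adjoin T iota) (kos_d X (m := m.+1)).
  split=> [i|i t v|i v].
  - exact: kos_dD.
  - case=> [[c ->]|[a ->]]; apply: kos_dZ => j p; [exact: XL|exact: XL].
  - exact: kos_dd.
have sP : splitting iota T (fun p => [seq (F i p, w i) | i <- enum 'I_N]).
  have sE (H : zmodType) (phi : A -> P -> H) p :
      ext phi [seq (F i p, w i) | i <- enum 'I_N] = \sum_i phi (F i p) (w i).
    by rewrite /ext big_map big_enum.
  split=> [H phi phiP p q|H phi phiP a p|H phi phiP _ p [c ->]|p]; rewrite !sE.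
  - by rewrite -big_split; apply: eq_bigr => i _; rewrite (lbD PP) (balDl phiP).
  - by apply: eq_bigr => i _; rewrite (lbL PP).
  - by apply: eq_bigr => i _; rewrite scalE (lbL PP) scalC (balZ phiP).
  - exact: (lbE PP).
have hP : contraction T (kos_d X (m := m.+1)) 0 (@kos_h _ _ X rho m.+1).
  split=> [i|i t v [c ->]|i _ v].
  - exact: kos_hD.
  - by apply: kos_hZ => j p; [exact: XL|exact: rhoZ'].
  - exact: kos_homotopy.
have [|h [hD hZ hE]] := dimA _ iota T _ _ iotaP TC Tk dP _ 0%N (ex_intro _ _ hP).
  by move=> i; apply: splitting_kos sP _ _.
pose H (v : kos P m.+1 m) : P := kos_proj (h m v).
have projD l : {morph @kos_proj _ P l : p q / p + q} by elim: l => //= l IHl p q; apply: IHl.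
have projZ l t (v : kos P l l) : kos_proj (t *: v) = t *: kos_proj v.
  by elim: l v => //= l IHl v; apply: IHl.
have HD : {morph H : p q / p + q} by move=> p q; rewrite /H hD projD.
have HZ t v : adjoin T iota t -> H (t *: v) = t *: H v.
  by move=> Tt; rewrite /H hZ // projZ.
have Htop p : H (kos_d X (kos_top m.+1 p)) = p.
  rewrite -[RHS](kos_topK m.+1) -[in RHS](hE m nm (kos_top m.+1 p)).
  by rewrite (kos_eq0 (h m.+1 _)) // (addm0 (@kos_dD _ _ _ XD _ _)) addr0.
have [K [KD KZ KE]] := kos_d_top XD HD HZ.
have KL (j : nat) : exists b, forall p, K j p = rmul p b.
  by apply: (endE PP) => [|a p]; [exact: KD|apply: KZ; right; exists a].
have [b bE] := choice KL.
have sum1 : \sum_(j < m.+1) x j * b j = 1.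
  apply: (faithful PP) => p; rewrite -[RHS]Htop KE.
  rewrite (addm_sum (f := fun s => rmul p s) (fun s s' => rmulDr p s s')).
  by apply: eq_bigr => j _; rewrite bE /X ltn_ord rmulA.
have : lam 1 = 0.
  rewrite -sum1 (addm_sum (lamD xP)) big1 // => j _.
  by rewrite (lam_seq xP).
by rewrite (lam1 xP) => /eqP; rewrite oner_eq0.
Qed.

Theorem theorem5p1 (k : fieldType) (n m : nat)
    (E : 'I_n -> quiver) (F : 'I_m -> quiver) :
  (1 <= n)%N -> (1 <= m)%N -> n <> m ->
  (forall i, has_nontrivial_closed_path (E i)) ->
  (forall j, has_nontrivial_closed_path (F j)) ->
  ~ morita_equivalent (bigtensor (fun i => leavitt k (E i)))
                      (bigtensor (fun j => leavitt k (F j))).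
Proof.
move=> n_gt0 m_gt0 nm pE pF AB.
have bound n' m' (E' : 'I_n' -> quiver) (F' : 'I_m' -> quiver) :
    (0 < n')%N -> (0 < m')%N -> (forall j, has_nontrivial_closed_path (F' j)) ->
    morita_equivalent (bigtensor (fun i => leavitt k (E' i)))
                      (bigtensor (fun j => leavitt k (F' j))) -> (m' <= n')%N.
  move=> n'_gt0 m'_gt0 pF' AB'.
  suff : (size (enum 'I_m') <= size (enum 'I_n'))%N by rewrite !size_enum_ord.
  apply: (dim_le_split_sequence _ _ AB').
    apply: dim_le_tensor_seq; last by rewrite size_enum_ord.
    by move=> i; apply: dim_le_leavitt.
  apply: tensor_seq_split_sequence; last by rewrite size_enum_ord.
  by move=> j; apply: leavitt_split_sequence.
have BA : morita_equivalent (bigtensor (fun j => leavitt k (F j)))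
                            (bigtensor (fun i => leavitt k (E i))).
  by case: AB => P [Q [PQ QP]]; exists Q, P.
by apply: nm; apply/eqP; rewrite eqn_leq (bound _ _ _ _ _ _ pE BA) ?(bound _ _ _ _ _ _ pF AB).
Qed.
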